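(* Assume that $L$ satisfies assumption (A) of the context, that $\sigma>0$, and that $\theta(x^* )>0$. Then the system of second order ODEs $$rV(x)=H\bigl(x,V'(x),p(x)\bigr)+\frac{(\sigma x)^2}{2}V''(x),\qquad (r+\lambda)(p(x)-1)=H_\xi\bigl(x,V'(x),p(x)\bigr)\,p'(x)+\frac{(\sigma x)^2}{2}p''(x),$$ with boundary conditions $$V(0)=0,\quad V(x^* )=B,\qquad p(0)=1,\quad p(x^* )=\theta(x^* ),$$ admits a $\mathcal C^2$ solution $(\overline V,\bar p)$, such that $\overline V:[0,x^*]\to[0,B]$ is increasing and $\bar p:[0,x^*]\to[\theta(x^* ),1]$ is decreasing.
   Context: Constants: $r>\mu\ge 0$, $\lambda>0$, $B>0$, $x^*>0$, the diffusion coefficient $\sigma$, and a number $\theta(x^* )\in[0,1]$. Assumption (A): $L$ is twice continuously differentiable on $[0,1[$ and satisfies $L(0)=0$, $L'>0$, $L''>0$, and $\lim_{u\to1-}L(u)=+\infty$ (so $L(1)=+\infty$). Hamiltonian: $$H(x,\xi,p)=\min_{\omega\in[0,1]}\Bigl\{L(\omega)-\frac{\xi}{p}\,\omega\Bigr\}+\Bigl(\frac{\lambda+r}{p}-\lambda+\sigma^2-\mu\Bigr)x\,\xi,$$ and $H_\xi$ denotes its partial derivative with respect to $\xi$. *)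

(* Defs.v *)
From Stdlib Require Import Reals Lra Psatz.
From Coquelicot Require Import Coquelicot.

Open Scope R_scope.

(* [D_in f g D x] and [continue_in f D x] only look at points of [D]: at an
   endpoint of an interval [D] belonging to [D] they are one-sided. *)
Definition C2_on (D : R -> Prop) (f f' f'' : R -> R) : Prop :=
  forall x, D x -> D_in f f' D x /\ D_in f' f'' D x /\ continue_in f'' D x.

Definition C0_on (D : R -> Prop) (f : R -> R) : Prop :=
  forall x, D x -> continue_in f D x.

Definition assumption_A (L : R -> R) : Prop :=
  exists L' L'' : R -> R,
    C2_on (fun u => 0 <= u < 1) L L' L'' /\
    L 0 = 0 /\
    (forall u, 0 <= u < 1 -> 0 < L' u) /\
    (forall u, 0 <= u < 1 -> 0 < L'' u) /\
    filterlim L (at_left 1) (Rbar_locally p_infty).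

(* [L] is only meaningful on [0,1[; this is its extension by [L(1) = +oo]. *)
Definition ext_cost (L : R -> R) (w : R) : Rbar :=
  if Rlt_dec w 1 then Finite (L w) else p_infty.

(* The minimum over [w] in [0,1] of [L(w) - a w], written as a greatest lower
   bound; it is attained under [assumption_A], see [min_cost_attained]. *)
Definition min_cost (L : R -> R) (a : R) : R :=
  real (Rbar_glb (fun y => exists w, 0 <= w <= 1 /\
                           y = Rbar_minus (ext_cost L w) (Finite (a * w)))).

Definition hamiltonian (L : R -> R) (r lambda mu sigma x xi p : R) : R :=
  min_cost L (xi / p)
  + ((lambda + r) / p - lambda + sigma ^ 2 - mu) * x * xi.

(* Under [assumption_A] the minimizer is unique and depends continuously on
   [xi], so that for [p > 0] this is a genuine derivative. *)
Definition hamiltonian_xi (L : R -> R) (r lambda mu sigma x xi p : R) : R :=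
  Derive (fun xi' => hamiltonian L r lambda mu sigma x xi' p) xi.

(* Classical solutions of the boundary value problem. The equations degenerate
   at [x = 0], where solutions are in general not C^2 and the boundary
   condition is attained by continuity; at [xstar] derivatives are one-sided. *)
Definition is_C2_solution (L : R -> R)
    (r lambda mu sigma B xstar theta : R) (V p : R -> R) : Prop :=
  C0_on (fun x => 0 <= x <= xstar) V /\
  C0_on (fun x => 0 <= x <= xstar) p /\
  (exists V' V'' p' p'' : R -> R,
    C2_on (fun x => 0 < x <= xstar) V V' V'' /\
    C2_on (fun x => 0 < x <= xstar) p p' p'' /\
    forall x, 0 < x <= xstar ->
      r * V x = hamiltonian L r lambda mu sigma x (V' x) (p x)
                + (sigma * x) ^ 2 / 2 * V'' x /\
      (r + lambda) * (p x - 1)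
      = hamiltonian_xi L r lambda mu sigma x (V' x) (p x) * p' x
        + (sigma * x) ^ 2 / 2 * p'' x) /\
  V 0 = 0 /\ V xstar = B /\ p 0 = 1 /\ p xstar = theta.

Lemma D_in_continue_in (f f' : R -> R) (D : R -> Prop) (x : R) :
  D_in f f' D x -> continue_in f D x.
Proof. exact (cont_deriv f f' D x). Qed.

Lemma min_cost_attained (L : R -> R) (a : R) : assumption_A L ->
  exists w, 0 <= w < 1 /\ min_cost L a = L w - a * w /\
    forall w', 0 <= w' < 1 -> L w - a * w <= L w' - a * w'.
Proof.
intros [L' [L'' [HC [L0 [_ [_ Hlim]]]]]].
assert (Hb : exists b, 0 <= b < 1 /\
                 forall u, b < u < 1 -> Rabs a < L u).
{ assert (HP : Rbar_locally p_infty (fun y => Rabs a < y)) by now exists (Rabs a).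
  destruct (Hlim _ HP) as [d Hd].
  exists (Rmax 0 (1 - d / 2)).
  pose proof (cond_pos d) as dpos.
  split.
  - split; [apply Rmax_l|apply Rmax_lub_lt; lra].
  - intros u [Hu1 Hu2].
    pose proof (Rmax_r 0 (1 - d / 2)).
    apply Hd; [|exact Hu2].
    unfold ball; simpl; unfold AbsRing_ball, abs, minus, plus, opp; simpl.
    rewrite Rabs_left; lra. }
destruct Hb as [b [Hb Hbig]].
set (g := fun u => L (Rmax 0 u) - a * Rmax 0 u).
assert (Hg : forall c, 0 <= c <= b -> continuity_pt g c).
{ intros c Hc.
  assert (HL : continuity_pt (fun u => L (Rmax 0 u)) c).
  { assert (Hc1 : 0 <= c < 1) by lra.
    destruct (HC c Hc1) as [HD _].
    apply D_in_continue_in in HD.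
    intros eps Heps.
    destruct (HD eps Heps) as [al [Hal HD']].
    exists (Rmin al (1 - c)). split.
    { apply Rmin_glb_lt; lra. }
    simpl in *. unfold Rdist in *.
    intros x [_ Hx].
    assert (Hx1 : Rabs (x - c) < al)
      by (eapply Rlt_le_trans; [exact Hx|apply Rmin_l]).
    assert (Hx2 : Rabs (x - c) < 1 - c)
      by (eapply Rlt_le_trans; [exact Hx|apply Rmin_r]).
    rewrite (Rmax_right 0 c) by lra.
    apply Rabs_lt_between in Hx1. apply Rabs_lt_between in Hx2.
    destruct (Req_dec (Rmax 0 x) c) as [->|Hne].
    { unfold Rminus. rewrite Rplus_opp_r, Rabs_R0. exact Heps. }
    apply HD'.
    revert Hne; unfold Rmax; destruct (Rle_dec 0 x); intros Hne; repeat split;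
      try lra; apply Rabs_lt_between; lra. }
  assert (Hmax : continuity_pt (fun u => a * Rmax 0 u) c).
  { apply continuity_pt_mult; [apply continuity_pt_const; now intros ? ?|].
    intros eps Heps. exists eps. split; [exact Heps|].
    simpl. unfold Rdist. intros x [_ Hx].
    apply Rabs_lt_between in Hx.
    apply Rabs_lt_between.
    unfold Rmax; destruct (Rle_dec 0 x), (Rle_dec 0 c); lra. }
  exact (continuity_pt_minus _ _ _ HL Hmax). }
destruct (continuity_ab_min g 0 b (proj1 Hb) Hg) as [w [Hw Hwb]].
assert (Hmin : forall w', 0 <= w' < 1 -> L w - a * w <= L w' - a * w').
{ assert (Hgw : g w = L w - a * w)
    by (unfold g; rewrite Rmax_right by lra; reflexivity).
  intros w' Hw'. rewrite <- Hgw.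
  destruct (Rle_lt_dec w' b) as [Hle|Hlt].
  - assert (Hg' : g w' = L w' - a * w')
      by (unfold g; rewrite Rmax_right by lra; reflexivity).
    rewrite <- Hg'. apply Hw. lra.
  - assert (Hg0 : g 0 = 0)
      by (unfold g; rewrite Rmax_right, L0 by lra; ring).
    assert (H1 : g w <= g 0) by (apply Hw; lra).
    assert (H2 : Rabs a < L w') by (apply Hbig; lra).
    pose proof (Rle_abs a). pose proof (Rabs_pos a).
    nra. }
exists w. split; [lra|]. split; [|exact Hmin].
unfold min_cost.
rewrite (Rbar_is_glb_unique _ (Finite (L w - a * w))); [reflexivity|].
split.
- intros y [w' [Hw' ->]]. unfold ext_cost.
  destruct (Rlt_dec w' 1); simpl; [|exact I].
  specialize (Hmin w' (conj (proj1 Hw') r)). lra.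
- intros l Hl.
  apply Hl. exists w. split; [lra|].
  unfold ext_cost. destruct (Rlt_dec w 1); [reflexivity|lra].
Qed.

(* Main.v *)
Require Import Defs.
From Stdlib Require Import Reals Lra Lia Arith Psatz.
From Stdlib Require Import Classical ClassicalEpsilon.
From Coquelicot Require Import Coquelicot.
From mathcomp.classical Require filter.
Open Scope R_scope.

(** Put [q = 1 - p] and discretize the system on the nodes [x_i = i h], [h =
    xstar / N], with forward differences for the drift [((lambda + r) / p -
    lambda + sigma^2 - mu) x], positive because [p <= 1], and backward
    differences for the drift [- w / p] coming from the minimum. This makes
    the scheme explicit: it computes [V_(i+1), q_(i+1)] from the previous
    values, and it preserves the nonnegativity of [V], [q] and of their
    slopes. Shooting from [V_0 = q_0 = 0] with initial slopes [a, b], the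
    terminal value [V_N] is 0 for [a = 0] and at least [h a] in general, and
    likewise for [q_N] and [b], so the two-dimensional Poincare-Miranda
    theorem yields [V_N = B], [q_N = 1 - theta].

    On [[d, xstar]], [d > 0], the discrete slopes are bounded uniformly in
    [N] by a discrete Gronwall estimate, because [h] times the sum of the
    slopes of [V] is [B] (similarly for [q]). Hence the discrete solutions
    converge, along an ultrafilter in [N], to a [C^2] solution on [(0,
    xstar]]. No barrier is needed at 0: a bounded nonnegative nondecreasing
    [f] with [k f <= s x^2 f'' + C x f'] and [k, s > 0] tends to 0 there. *)

(** * Limits along an ultrafilter *)

(** Limits along one ultrafilter finer than [eventually] replace the successive extraction of
    subsequences: every bounded sequence has such a limit. *)
Lemma ultrafilter_on_nat :
  exists U : (nat -> Prop) -> Prop,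
    ProperFilter U /\ (forall P, U P \/ U (fun n => ~ P n)) /\
    filter_le U eventually.
Proof.
assert (HE : @filter.ProperFilter nat eventually).
{ destruct eventually_filter as [Hex [Ht Ha Hi]].
  split.
  - intros H. destruct (Hex _ H) as [x []].
  - split; [exact Ht|exact Ha|exact Hi]. }
destruct (filter.ultraFilterLemma HE) as [U [HU HsU]].
exists U. pose proof (@filter.ultra_proper _ _ HU) as [HU0 [HUt HUa HUi]].
split; [|split].
- split; [|split; [exact HUt|exact HUa|exact HUi]].
  (* Members of a proper filter must be inhabited here, whereas properness of [U] only says that the
     empty set is not a member; excluded middle bridges the two. *)
  intros P HP. apply NNPP. intros Hn. apply HU0.
  apply (HUi P); [|exact HP].
  intros x Hx. apply Hn. now exists x.
- intros P. exact (filter.in_ultra_setVsetC P HU).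
- intros P HP. now apply HsU.
Qed.

Lemma filterlim_R {T : Type} (F : (T -> Prop) -> Prop) {FF : Filter F}
    (f : T -> R) (l : R) :
  filterlim f F (locally l) <-> forall eps, 0 < eps -> F (fun t => Rabs (f t - l) < eps).
Proof.
split.
- intros H eps Heps. exact (proj1 (filterlim_locally f l) H (mkposreal eps Heps)).
- intros H. apply filterlim_locally. intros [eps Heps]. exact (H eps Heps).
Qed.

(** The limit is the supremum of those [t] lying below [a n] for [U]-most [n]; the ultrafilter
    dichotomy decides each comparison, which gives both one-sided estimates. *)
Lemma ultralimit_exists (U : (nat -> Prop) -> Prop) (a : nat -> R) (K : R) :
  ProperFilter U -> (forall P, U P \/ U (fun n => ~ P n)) ->
  U (fun n => Rabs (a n) <= K) -> exists l : R, filterlim a U (locally l).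
Proof.
intros PU HU HK.
destruct (completeness (fun t => U (fun n => t <= a n))) as [l [Hub Hlub]].
- exists K. intros t Ht.
  destruct (filter_ex _ (filter_and _ _ Ht HK)) as [n [H1 H2]].
  apply Rabs_le_between in H2. lra.
- exists (- K). revert HK. apply filter_imp. intros n Hn.
  apply Rabs_le_between in Hn. lra.
- exists l. apply filterlim_R; [apply PU|]. intros eps Heps.
  assert (H1 : U (fun n => a n < l + eps)).
  { destruct (HU (fun n => l + eps <= a n)) as [H|H].
    - apply Hub in H. lra.
    - revert H. apply filter_imp. intros n. lra. }
  assert (H2 : U (fun n => l - eps < a n)).
  { destruct (HU (fun n => l - eps < a n)) as [H|H]; [exact H|exfalso].
    assert (l <= l - eps); [|lra].
    apply Hlub. intros t Ht.
    destruct (filter_ex _ (filter_and _ _ Ht H)) as [n [H3 H4]]. lra. }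
  generalize (filter_and _ _ H1 H2). apply filter_imp.
  intros n []. apply Rabs_lt_between. lra.
Qed.

Section RealLimits.
Context {T : Type} {F : (T -> Prop) -> Prop} {FF : Filter F}.
Implicit Types (f g : T -> R) (l m : R).

Lemma filterlim_Rplus f g l m :
  filterlim f F (locally l) -> filterlim g F (locally m) ->
  filterlim (fun t => f t + g t) F (locally (l + m)).
Proof.
intros Hf Hg. exact (filterlim_comp_2 _ _ _ Hf Hg (filterlim_plus l m)).
Qed.

Lemma filterlim_Rmult f g l m :
  filterlim f F (locally l) -> filterlim g F (locally m) ->
  filterlim (fun t => f t * g t) F (locally (l * m)).
Proof.
intros Hf Hg. exact (filterlim_comp_2 _ _ _ Hf Hg (filterlim_mult l m)).
Qed.

Lemma filterlim_continuous (k : R -> R) f l :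
  continuous k l -> filterlim f F (locally l) ->
  filterlim (fun t => k (f t)) F (locally (k l)).
Proof. intros Hk Hf. exact (filterlim_comp _ _ _ _ _ _ _ _ Hf Hk). Qed.

Lemma filterlim_Rminus f g l m :
  filterlim f F (locally l) -> filterlim g F (locally m) ->
  filterlim (fun t => f t - g t) F (locally (l - m)).
Proof.
intros Hf Hg. apply filterlim_Rplus; [exact Hf|].
apply (filterlim_continuous Ropp); [|exact Hg].
exact (continuous_opp (fun x : R => x) m (continuous_id m)).
Qed.

Lemma filterlim_Rdiv f g l m :
  m <> 0 -> filterlim f F (locally l) -> filterlim g F (locally m) ->
  filterlim (fun t => f t / g t) F (locally (l / m)).
Proof.
intros Hm Hf Hg. apply filterlim_Rmult; [exact Hf|].
apply (filterlim_continuous Rinv); [|exact Hg].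
exact (continuous_Rinv_comp (fun x : R => x) m (continuous_id m) Hm).
Qed.
End RealLimits.

Lemma filterlim_R_le {T : Type} {F : (T -> Prop) -> Prop} {FF : ProperFilter F}
    (f g : T -> R) (l m : R) :
  F (fun t => f t <= g t) -> filterlim f F (locally l) ->
  filterlim g F (locally m) -> l <= m.
Proof. exact (filterlim_le f g (Finite l) (Finite m)). Qed.

(** * The Poincare-Miranda theorem in the plane *)

Definition edge12 (a b : nat) : bool :=
  match a, b with 1%nat, 2%nat | 2%nat, 1%nat => true | _, _ => false end.

Definition trichromatic (a b c : nat) : Prop :=
  (a = 0 \/ b = 0 \/ c = 0)%nat /\ (a = 1 \/ b = 1 \/ c = 1)%nat /\
  (a = 2 \/ b = 2 \/ c = 2)%nat.

(** Around a triangle that misses a colour, the number of {1,2}-edges is even; this is stated as two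
    sides against the third so that it can be used for rewriting. *)
Lemma not_trichromatic_parity (a b c : nat) :
  (a <= 2)%nat -> (b <= 2)%nat -> (c <= 2)%nat -> ~ trichromatic a b c ->
  xorb (edge12 a b) (edge12 b c) = edge12 a c.
Proof.
unfold trichromatic. intros Ha Hb Hc H.
destruct a as [|[|[|]]], b as [|[|[|]]], c as [|[|[|]]]; try reflexivity; try lia;
  exfalso; apply H; lia.
Qed.

Fixpoint row_parity (col : nat -> nat) (m : nat) : bool :=
  match m with
  | O => false
  | S k => xorb (row_parity col k) (edge12 (col k) (col (S k)))
  end.

(* The parity of the number of {1,2}-edges is the same on every row, since a
   cell without trichromatic triangle has an even number of them on its border. *)
Lemma sperner_square (m : nat) (col : nat -> nat -> nat) :
  (forall i j, (col i j <= 2)%nat) ->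
  (forall j, (j <= m)%nat -> col 0%nat j = 1%nat) ->
  (forall j, (j <= m)%nat -> col m j <> 1%nat) ->
  (forall i, (i <= m)%nat -> col i 0%nat <> 0%nat) ->
  (forall i, (i <= m)%nat -> col i m <> 2%nat) ->
  exists i j, (i < m)%nat /\ (j < m)%nat /\
    (trichromatic (col i j) (col (S i) j) (col (S i) (S j)) \/
     trichromatic (col i j) (col i (S j)) (col (S i) (S j))).
Proof.
intros H2 Hl Hr Hb Ht. apply NNPP. intros Hno.
(* The two triangles of a cell share the diagonal, and both broken lines from corner to corner have
   the parity of that diagonal. *)
assert (Hcell : forall i j, (i < m)%nat -> (j < m)%nat ->
  xorb (edge12 (col i j) (col (S i) j)) (edge12 (col (S i) j) (col (S i) (S j))) =
  xorb (edge12 (col i j) (col i (S j))) (edge12 (col i (S j)) (col (S i) (S j)))).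
{ intros i j Hi Hj.
  rewrite !not_trichromatic_parity; auto; intros H; apply Hno; exists i, j; auto. }
assert (Hrow : forall j i, (j < m)%nat -> (i <= m)%nat ->
  xorb (row_parity (fun k => col k j) i) (row_parity (fun k => col k (S j)) i) =
  xorb (edge12 (col 0%nat j) (col 0%nat (S j))) (edge12 (col i j) (col i (S j)))).
{ intros j i Hj. induction i as [|i IH]; intros Hi.
  - simpl. now destruct edge12.
  - simpl. specialize (IH ltac:(lia)). specialize (Hcell i j ltac:(lia) Hj).
    revert IH Hcell.
    generalize (edge12 (col 0%nat j) (col 0%nat (S j))).
    repeat match goal with |- context [edge12 ?a ?b] => generalize (edge12 a b) end.
    generalize (row_parity (fun k => col k j) i) (row_parity (fun k => col k (S j)) i).
    intros [] [] [] [] [] [] []; simpl; congruence. }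
(* Vertical edges join 1 to 1 on the left border and avoid 1 on the right one, so neither border
   contributes. *)
assert (Hconst : forall j, (j <= m)%nat ->
  row_parity (fun k => col k j) m = row_parity (fun k => col k 0%nat) m).
{ induction j as [|j IH]; intros Hj; [reflexivity|].
  rewrite <- IH by lia.
  specialize (Hrow j m ltac:(lia) (le_n m)).
  rewrite (Hl j), (Hl (S j)) in Hrow by lia.
  assert (He : edge12 (col m j) (col m (S j)) = false).
  { pose proof (Hr j ltac:(lia)). pose proof (Hr (S j) ltac:(lia)).
    destruct (col m j) as [|[|[|]]], (col m (S j)) as [|[|[|]]]; try reflexivity; lia. }
  rewrite He in Hrow. simpl in Hrow.
  now destruct (row_parity (fun k => col k j) m), (row_parity (fun k => col k (S j)) m). }
assert (Htop : forall i, (i <= m)%nat -> row_parity (fun k => col k m) i = false).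
{ induction i as [|i IH]; intros Hi; [reflexivity|]. simpl. rewrite IH by lia.
  pose proof (Ht i ltac:(lia)). pose proof (Ht (S i) Hi).
  destruct (col i m) as [|[|[|]]], (col (S i) m) as [|[|[|]]]; try reflexivity; lia. }
(* The bottom row starts at 1 and uses only 1 and 2, so the parity records whether the current
   colour is 2. At [m] it is 2, hence odd, against the even top row. *)
assert (Hbot : forall i, (i <= m)%nat ->
  row_parity (fun k => col k 0%nat) i = Nat.eqb (col i 0%nat) 2).
{ induction i as [|i IH]; intros Hi.
  - simpl. now rewrite Hl by lia.
  - simpl. rewrite IH by lia.
    pose proof (Hb i ltac:(lia)). pose proof (Hb (S i) Hi).
    pose proof (H2 i 0%nat). pose proof (H2 (S i) 0%nat).
    destruct (col i 0%nat) as [|[|[|]]], (col (S i) 0%nat) as [|[|[|]]];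
      try reflexivity; lia. }
pose proof (Hconst m (le_n m)) as E. rewrite Htop, Hbot in E by lia.
pose proof (Hr 0%nat ltac:(lia)). pose proof (Hb m (le_n m)). pose proof (H2 m 0%nat).
destruct (col m 0%nat) as [|[|[|]]]; simpl in E; try lia; discriminate.
Qed.

Lemma filterlim_div_INR (U : (nat -> Prop) -> Prop) (a : R) :
  Filter U -> filter_le U eventually ->
  filterlim (fun n => a / INR (S n)) U (locally 0).
Proof.
intros FU HU. apply (filterlim_filter_le_1 _ HU).
apply (is_lim_seq_incr_1 (fun n => a / INR n) 0).
replace (Finite 0) with (Rbar_mult a (Rbar_inv p_infty))
  by (simpl; f_equal; ring).
apply is_lim_seq_scal_l, is_lim_seq_inv; [apply is_lim_seq_INR|discriminate].
Qed.

Ltac case_if := match goal with |- context [if ?b then _ else _] => destruct b end.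

(** Sperner's lemma on finer and finer grids, coloured by the signs of [f] and [g], gives cells
    where both functions take both weak signs; continuity forces zeros at an ultralimit of these
    cells. *)
Lemma poincare_miranda (f g : R * R -> R) (a b : R) :
  0 <= a -> 0 <= b ->
  (forall z, continuous f z) -> (forall z, continuous g z) ->
  (forall y, 0 <= y <= b -> f (0, y) <= 0) ->
  (forall y, 0 <= y <= b -> 0 <= f (a, y)) ->
  (forall x, 0 <= x <= a -> g (x, 0) <= 0) ->
  (forall x, 0 <= x <= a -> 0 <= g (x, b)) ->
  exists x y, 0 <= x <= a /\ 0 <= y <= b /\ f (x, y) = 0 /\ g (x, y) = 0.
Proof.
intros Ha Hb Cf Cg Hf0 Hfa Hg0 Hgb.
set (pt := fun n i c => c / INR (S n) * INR i).
assert (Hpt : forall n i c, (i <= S n)%nat -> 0 <= c -> 0 <= pt n i c <= c).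
{ intros n i c Hi Hc. unfold pt.
  pose proof (pos_INR i). apply le_INR in Hi.
  pose proof (lt_0_INR (S n) ltac:(lia)).
  assert (0 <= c / INR (S n)) by now apply Rdiv_le_0_compat.
  assert (c / INR (S n) * INR (S n) = c) by (field; lra). nra. }
set (near := fun n (z z' : R * R) =>
  Rabs (fst z' - fst z) <= a / INR (S n) /\ Rabs (snd z' - snd z) <= b / INR (S n)).
assert (Hcell : forall n, exists z, (0 <= fst z <= a /\ 0 <= snd z <= b) /\
  (exists z', near n z z' /\ 0 <= f z') /\ (exists z', near n z z' /\ 0 <= - f z') /\
  (exists z', near n z z' /\ 0 <= g z') /\ (exists z', near n z z' /\ 0 <= - g z')).
{ intros n.
  set (v := fun i j => (pt n i a, pt n j b)).
  (* Colour 1 entails [f <= 0], colour 2 entails [g <= 0], colour 0 that both are nonnegative. The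
     left and bottom borders are coloured by fiat, which the sign hypotheses there allow even where
     [f] or [g] vanishes. *)
  set (col := fun i j =>
    if Nat.eqb i 0 then 1%nat else if Rlt_dec (f (v i j)) 0 then 1%nat else
    if Nat.eqb j 0 then 2%nat else if Rlt_dec (g (v i j)) 0 then 2%nat else 0%nat).
  assert (E0 : forall c, pt n 0%nat c = 0) by (intros; unfold pt; simpl; ring).
  assert (Em : forall c, pt n (S n) c = c)
    by (intros; unfold pt; field; apply not_0_INR; lia).
  assert (Hcol : forall i j, (i <= S n)%nat -> (j <= S n)%nat ->
    (col i j = 0%nat -> 0 <= f (v i j) /\ 0 <= g (v i j)) /\
    (col i j = 1%nat -> f (v i j) <= 0) /\ (col i j = 2%nat -> g (v i j) <= 0)).
  { intros i j Hi Hj. unfold col.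
    destruct (Nat.eqb_spec i 0) as [->|Hi0].
    { repeat split; try discriminate. intros _. unfold v. rewrite E0. auto. }
    destruct Rlt_dec; [repeat split; try discriminate; lra|].
    destruct (Nat.eqb_spec j 0) as [->|Hj0].
    { repeat split; try discriminate. intros _. unfold v. rewrite E0. auto. }
    destruct Rlt_dec; repeat split; try discriminate; lra. }
  destruct (sperner_square (S n) col) as [i [j [Hi [Hj H]]]].
  - intros i j. unfold col.
    repeat case_if; lia.
  - reflexivity.
  - intros j Hj. unfold col. simpl (Nat.eqb (S n) 0).
    destruct Rlt_dec as [Hlt|]; [|repeat case_if; lia].
    exfalso. unfold v in Hlt. rewrite Em in Hlt.
    specialize (Hfa (pt n j b) (Hpt n j b Hj Hb)). lra.
  - intros i Hi. unfold col.
    case_if; [lia|]. case_if; [lia|]. simpl. lia.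
  - intros i Hi. unfold col. simpl (Nat.eqb (S n) 0).
    case_if; [lia|]. destruct Rlt_dec; [lia|].
    destruct Rlt_dec as [Hlt|]; [|lia].
    exfalso. unfold v in Hlt. rewrite Em in Hlt.
    specialize (Hgb (pt n i a) (Hpt n i a Hi Ha)). lra.
  - assert (Hnear : forall i' j', (i' = i \/ i' = S i) -> (j' = j \/ j' = S j) ->
      near n (v i j) (v i' j')).
    { assert (Hstep : forall c k k', 0 <= c -> (k' = k \/ k' = S k) ->
        Rabs (pt n k' c - pt n k c) <= c / INR (S n)).
      { intros c k k' Hc Hk.
        assert (0 <= c / INR (S n)) by (apply Rdiv_le_0_compat; [|apply lt_0_INR]; lia || lra).
        unfold pt. apply Rabs_le_between.
        destruct Hk as [->| ->]; [lra|]. rewrite (S_INR k). lra. }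
      intros i' j' Hi' Hj'. split; apply Hstep; auto. }
    exists (v i j). split; [split; apply Hpt; lia || lra|].
    assert (Hall : forall k, (k <= 2)%nat -> exists i0 j0,
      (i0 = i \/ i0 = S i) /\ (j0 = j \/ j0 = S j) /\ col i0 j0 = k).
    { unfold trichromatic in H. intros k Hk.
      destruct k as [|[|[|]]]; [| | |lia];
        destruct H as [[A0 [A1 A2]]|[A0 [A1 A2]]];
        (destruct A0 as [A0|[A0|A0]] || idtac);
        (destruct A1 as [A1|[A1|A1]] || idtac);
        (destruct A2 as [A2|[A2|A2]] || idtac); eauto 8. }
    destruct (Hall 0%nat) as [i0 [j0 [I0 [J0 C0]]]]; [lia|].
    destruct (Hall 1%nat) as [i1 [j1 [I1 [J1 C1]]]]; [lia|].
    destruct (Hall 2%nat) as [i2 [j2 [I2 [J2 C2]]]]; [lia|].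
    apply Hcol in C0; [|lia|lia]. apply Hcol in C1; [|lia|lia]. apply Hcol in C2; [|lia|lia].
    repeat split.
    + exists (v i0 j0). split; [auto|lra].
    + exists (v i1 j1). split; [auto|lra].
    + exists (v i0 j0). split; [auto|lra].
    + exists (v i2 j2). split; [auto|lra]. }
destruct (ultrafilter_on_nat) as [U [PU [HU HUe]]].
pose proof (@filter_filter _ _ PU) as FU.
set (z := fun n => proj1_sig (constructive_indefinite_description _ (Hcell n))).
assert (Hz := fun n => proj2_sig (constructive_indefinite_description _ (Hcell n))).
fold z in Hz.
destruct (ultralimit_exists U (fun n => fst (z n)) a PU HU) as [x Hx].
{ apply filter_forall. intros n. destruct (Hz n) as [[Hn _] _].
  fold (z n) in Hn. apply Rabs_le_between. lra. }
destruct (ultralimit_exists U (fun n => snd (z n)) b PU HU) as [y Hy].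
{ apply filter_forall. intros n. destruct (Hz n) as [[_ Hn] _].
  fold (z n) in Hn. apply Rabs_le_between. lra. }
(* If [k] were negative at the limit, it would be negative in a neighbourhood, which contains the
   witness [z'] of some cell. *)
assert (Hlim : forall k : R * R -> R, continuous k (x, y) ->
  (forall n, exists z', near n (z n) z' /\ 0 <= k z') -> 0 <= k (x, y)).
{ intros k Ck Hk. apply Rnot_lt_le. intros Hneg.
  assert (Hl : locally (x, y) (fun z' => k z' < 0)).
  { apply (Ck (fun t => t < 0)). now apply (open_lt 0). }
  destruct Hl as [e He].
  assert (He2 : 0 < e / 2) by (pose proof (cond_pos e); lra).
  pose proof (proj1 (filterlim_R U _ _) Hx _ He2) as Hx'.
  pose proof (proj1 (filterlim_R U _ _) Hy _ He2) as Hy'.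
  pose proof (proj1 (filterlim_R U _ _) (filterlim_div_INR U a FU HUe) _ He2) as Ha'.
  pose proof (proj1 (filterlim_R U _ _) (filterlim_div_INR U b FU HUe) _ He2) as Hb'.
  destruct (filter_ex _ (filter_and _ _ (filter_and _ _ Hx' Hy') (filter_and _ _ Ha' Hb')))
    as [n [[B1 B2] [B3 B4]]].
  destruct (Hk n) as [z' [[N1 N2] Hz']].
  assert (k z' < 0); [|lra].
  apply He. apply Rabs_lt_between in B1, B2, B3, B4. apply Rabs_le_between in N1, N2.
  split; apply Rabs_lt_between; unfold minus, plus, opp; cbn in *; lra. }
exists x, y.
assert (Hxb : 0 <= x <= a).
{ split.
  - apply (filterlim_R_le (F := U) (fun _ => 0) _ _ _
      (filter_forall _ (fun n => proj1 (proj1 (proj1 (Hz n)))))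
      (filterlim_const 0) Hx).
  - apply (filterlim_R_le (F := U) _ (fun _ => a) _ _
      (filter_forall _ (fun n => proj2 (proj1 (proj1 (Hz n)))))
      Hx (filterlim_const a)). }
assert (Hyb : 0 <= y <= b).
{ split.
  - apply (filterlim_R_le (F := U) (fun _ => 0) _ _ _
      (filter_forall _ (fun n => proj1 (proj2 (proj1 (Hz n)))))
      (filterlim_const 0) Hy).
  - apply (filterlim_R_le (F := U) _ (fun _ => b) _ _
      (filter_forall _ (fun n => proj2 (proj2 (proj1 (Hz n)))))
      Hy (filterlim_const b)). }
assert (0 <= f (x, y)) by (apply Hlim; [apply Cf|apply Hz]).
assert (0 <= - f (x, y)).
{ apply (Hlim (fun z => - f z)); [apply (continuous_opp f), Cf|apply Hz]. }
assert (0 <= g (x, y)) by (apply Hlim; [apply Cg|apply Hz]).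
assert (0 <= - g (x, y)).
{ apply (Hlim (fun z => - g z)); [apply (continuous_opp g), Cg|apply Hz]. }
repeat split; lra.
Qed.

(** * The minimal cost and its derivative *)

Lemma D_in_is_derive (f f' : R -> R) (D : R -> Prop) (x : R) :
  locally x D -> D_in f f' D x -> is_derive f x (f' x).
Proof.
intros [d Hd] H. apply is_derive_Reals. intros eps Heps.
destruct (H eps Heps) as [al [Hal H']].
assert (Hm : 0 < Rmin al d) by (apply Rmin_glb_lt; [lra|apply cond_pos]).
exists (mkposreal _ Hm). intros h Hh0 Hh. simpl in Hh.
specialize (H' (x + h)). simpl in H'. unfold Rdist in H'.
replace (x + h - x) with h in H' by ring. apply H'.
pose proof (Rmin_l al d). pose proof (Rmin_r al d). split; [split|lra].
- apply Hd. change (Rabs (x + h - x) < d). replace (x + h - x) with h by ring. lra.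
- lra.
Qed.

Lemma is_derive_D_in (f f' : R -> R) (D : R -> Prop) (x : R) :
  is_derive f x (f' x) -> D_in f f' D x.
Proof.
intros H. apply is_derive_Reals in H. intros eps Heps.
destruct (H eps Heps) as [d Hd]. exists d. split; [apply cond_pos|].
simpl. unfold Rdist. intros y [[_ Hy] Hyd].
specialize (Hd (y - x) ltac:(lra) Hyd). now replace (x + (y - x)) with y in Hd by ring.
Qed.

(** Derivatives at [a] and [b] are only relative to [D]. Composing [f] with the clamp [cl] to
    [[a, b]] gives two-sided continuity at the endpoints too, and the usual mean value theorem
    applies. *)
Lemma mean_value_D_in (f f' : R -> R) (D : R -> Prop) (a b : R) :
  a < b -> (forall u, a <= u <= b -> D u /\ D_in f f' D u) ->
  exists c, a < c < b /\ f b - f a = f' c * (b - a).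
Proof.
intros Hab HD.
set (cl := fun u => Rmax a (Rmin b u)).
assert (Hcl : forall u, a <= u <= b -> cl u = u).
{ intros u Hu. unfold cl. rewrite Rmin_right, Rmax_right; lra. }
assert (Hcl1 : forall u, a <= cl u <= b).
{ intros u. unfold cl, Rmin, Rmax. repeat destruct Rle_dec; lra. }
assert (Hcl2 : forall u c, a <= c <= b -> Rabs (cl u - c) <= Rabs (u - c)).
{ intros u c Hc. unfold cl, Rmin, Rmax, Rabs.
  repeat destruct Rle_dec; repeat destruct Rcase_abs; lra. }
assert (Hder : forall c, a < c < b -> is_derive (fun u => f (cl u)) c (f' c)).
{ intros c Hc.
  assert (Hl : locally c (fun u => a <= u <= b))
    by (apply (locally_interval _ c a b); simpl; intros; lra).
  apply (is_derive_ext_loc f).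
  - revert Hl. apply filter_imp. intros u Hu. now rewrite Hcl.
  - apply (D_in_is_derive f f' D); [|apply HD; lra].
    revert Hl. apply filter_imp. intros u Hu. now apply HD. }
assert (Hcont : forall c, a <= c <= b -> continuity_pt (fun u => f (cl u)) c).
{ intros c Hc eps Heps. destruct (HD c Hc) as [_ HDc]. apply D_in_continue_in in HDc.
  destruct (HDc eps Heps) as [al [Hal H]]. exists al. split; [exact Hal|].
  simpl in *. unfold Rdist in *. intros u [_ Hu]. rewrite (Hcl c Hc).
  destruct (Req_dec (cl u) c) as [->|Hne]; [now rewrite Rminus_diag, Rabs_R0|].
  apply H. split; [split; [apply HD, Hcl1|auto]|].
  specialize (Hcl2 u c Hc). lra. }
destruct (MVT (fun u => f (cl u)) id a b
  (fun c Hc => exist _ (f' c) (proj1 (is_derive_Reals _ _ _) (Hder c Hc)))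
  (fun c _ => derivable_pt_id c) Hab Hcont) as [c [Hc E]].
{ intros c _. apply derivable_continuous_pt, derivable_pt_id. }
exists c. split; [exact Hc|].
rewrite derive_pt_id in E. simpl in E. unfold id in E.
rewrite !Hcl in E by lra. lra.
Qed.

Lemma D_in_nondecreasing (f f' : R -> R) (D : R -> Prop) (a b : R) :
  a <= b -> (forall u, a <= u <= b -> D u /\ D_in f f' D u /\ 0 <= f' u) -> f a <= f b.
Proof.
intros [Hab| ->] H; [|lra].
destruct (mean_value_D_in f f' D a b Hab) as [c [Hc E]].
{ intros u Hu. destruct (H u Hu) as [H1 [H2 _]]. now split. }
destruct (H c ltac:(lra)) as [_ [_ H3]]. nra.
Qed.

(** The two chord slopes are values of [L'] at ordered points, and a third mean value, for [L'],
    brings in [L'' > 0]; denominators are cleared. *)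
Lemma convex_slopes (L : R -> R) (x y z : R) :
  assumption_A L -> 0 <= x -> x < y -> y < z -> z < 1 ->
  (L y - L x) * (z - y) < (L z - L y) * (y - x).
Proof.
intros [L' [L'' [HC [_ [_ [HL'' _]]]]]] Hx Hxy Hyz Hz.
assert (HD : forall a b, a < b -> 0 <= a -> b < 1 -> exists c, a < c < b /\ L b - L a = L' c * (b - a)).
{ intros a b Hab Ha Hb. apply (mean_value_D_in L L' (fun u => 0 <= u < 1) a b Hab).
  intros u Hu. split; [lra|]. apply HC. lra. }
destruct (HD x y) as [c1 [Hc1 E1]]; try lra.
destruct (HD y z) as [c2 [Hc2 E2]]; try lra.
destruct (mean_value_D_in L' L'' (fun u => 0 <= u < 1) c1 c2) as [c [Hc E]]; try lra.
{ intros u Hu. split; [lra|]. apply HC. lra. }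
rewrite E1, E2. specialize (HL'' c ltac:(lra)).
assert (0 < L' c2 - L' c1) by (rewrite E; apply Rmult_lt_0_compat; lra).
assert (0 < (y - x) * (z - y)) by (apply Rmult_lt_0_compat; lra).
nra.
Qed.

Lemma cost_nonneg (L : R -> R) (x : R) : assumption_A L -> 0 <= x < 1 -> 0 <= L x.
Proof.
intros [L' [L'' [HC [H0 [HL' _]]]]] Hx.
destruct (Req_dec x 0) as [->|]; [lra|].
destruct (mean_value_D_in L L' (fun u => 0 <= u < 1) 0 x) as [c [Hc E]]; try lra.
{ intros u Hu. split; [lra|]. apply HC. lra. }
specialize (HL' c ltac:(lra)). nra.
Qed.

(** Testing with [w = 0] gives the upper bound; [L >= 0] and [w < 1] give the lower one. *)
Lemma min_cost_bounds (L : R -> R) (a : R) : assumption_A L -> 0 <= a ->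
  - a <= min_cost L a <= 0.
Proof.
intros HA Ha. destruct (min_cost_attained L a HA) as [w [Hw [-> Hmin]]].
pose proof (cost_nonneg L w HA Hw).
assert (L 0 = 0) by (destruct HA as [? [? [_ [? _]]]]; assumption).
specialize (Hmin 0 ltac:(lra)). nra.
Qed.

(* Danskin: comparing the minimizers [w a] and [w b] puts [M b - M a] between
   [- (b - a) w b] and [- (b - a) w a]; so [M' = - w] once [w] is continuous,
   which follows from the strict convexity of [L]. *)
Lemma min_cost_derivative (L : R -> R) : assumption_A L ->
  exists w : R -> R, (forall a, 0 <= w a < 1) /\ (forall a, continuous w a) /\
    (forall a, is_derive (min_cost L) a (- w a)).
Proof.
intros HA.
set (w := fun a => proj1_sig (constructive_indefinite_description _ (min_cost_attained L a HA))).
assert (Hw := fun a => proj2_sig (constructive_indefinite_description _ (min_cost_attained L a HA))).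
assert (Hw1 : forall a, 0 <= w a < 1) by (intros a; apply (Hw a)).
assert (Hw2 : forall a, min_cost L a = L (w a) - a * w a) by (intros a; apply (Hw a)).
assert (Hw3 : forall a w', 0 <= w' < 1 -> L (w a) - a * w a <= L w' - a * w')
  by (intros a; apply (Hw a)).
clearbody w. clear Hw.
assert (Hcont : forall a, continuous w a).
{ intros a. apply (filterlim_R (locally a)). intros eps Heps.
  (* If [w b] reached [w a + eps], minimality at [b] and convexity would make the chord slope of [L]
     from [w a] to [v = w a + eps / 2] less than [b]; but by [Hgap] it exceeds [a] by a fixed
     amount. *)
  assert (Hup : exists d, 0 < d /\ forall b, Rabs (b - a) < d -> w b < w a + eps).
  { destruct (Rlt_le_dec (w a + eps) 1) as [Hlt|Hle].
    2:{ exists 1. split; [lra|]. intros b _. specialize (Hw1 b). lra. }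
    set (e := eps / 2).
    set (v := w a + e).
    assert (He : 0 < e) by (unfold e; lra).
    assert (Hv : v < 1) by (unfold v, e; lra).
    specialize (Hw1 a) as Hwa.
    (* Minimality at [a] makes the first half of the chord at least as steep as [a]; strict
       convexity makes the second half steeper. *)
    assert (Hgap : 0 < L v - L (w a) - a * e).
    { pose proof (convex_slopes L (w a) (w a + e / 2) v HA) as Hcv.
      specialize (Hcv ltac:(lra) ltac:(lra) ltac:(unfold v; lra) Hv).
      pose proof (Hw3 a (w a + e / 2) ltac:(unfold v in Hv; lra)).
      unfold v in *. nra. }
    exists ((L v - L (w a) - a * e) / e).
    split; [now apply Rdiv_lt_0_compat|].
    intros b Hb. apply Rnot_le_lt. intros Hwb.
    assert (Hwb' : v < w b) by (unfold v, e; lra).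
    pose proof (convex_slopes L (w a) v (w b) HA ltac:(lra) ltac:(unfold v; lra) Hwb'
      (proj2 (Hw1 b))) as Hcv.
    pose proof (Hw3 b (w a) Hwa) as Hb1. pose proof (Hw3 b v ltac:(unfold v in *; lra)) as Hb2.
    assert (Rabs (b - a) * e < L v - L (w a) - a * e).
    { apply (Rmult_lt_compat_r e) in Hb; [|lra]. unfold Rdiv in Hb.
      rewrite Rmult_assoc, Rinv_l, Rmult_1_r in Hb; lra. }
    pose proof (Rle_abs (b - a)).
    assert ((b - a) * e <= Rabs (b - a) * e) by (apply Rmult_le_compat_r; lra).
    assert (v - w a = e) by (unfold v; ring).
    nra. }
  (* The mirror image, with [v] to the left of [w a]. *)
  assert (Hdown : exists d, 0 < d /\ forall b, Rabs (b - a) < d -> w a - eps < w b).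
  { destruct (Rlt_le_dec (w a - eps) 0) as [Hlt|Hle].
    { exists 1. split; [lra|]. intros b _. specialize (Hw1 b). lra. }
    set (e := eps / 2).
    set (v := w a - e).
    assert (He : 0 < e) by (unfold e; lra).
    assert (Hv : 0 <= v) by (unfold v, e; lra).
    specialize (Hw1 a) as Hwa.
    assert (Hgap : 0 < L v - L (w a) + a * e).
    { pose proof (convex_slopes L v (w a - e / 2) (w a) HA) as Hcv.
      specialize (Hcv Hv ltac:(unfold v; lra) ltac:(lra) (proj2 Hwa)).
      pose proof (Hw3 a (w a - e / 2) ltac:(unfold v in Hv; lra)).
      unfold v in *. nra. }
    exists ((L v - L (w a) + a * e) / e).
    split; [now apply Rdiv_lt_0_compat|].
    intros b Hb. apply Rnot_le_lt. intros Hwb.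
    assert (Hwb' : w b < v) by (unfold v, e; lra).
    pose proof (convex_slopes L (w b) v (w a) HA (proj1 (Hw1 b)) Hwb' ltac:(unfold v; lra)
      (proj2 Hwa)) as Hcv.
    pose proof (Hw3 b (w a) Hwa) as Hb1. pose proof (Hw3 b v ltac:(unfold v in *; lra)) as Hb2.
    assert (Rabs (b - a) * e < L v - L (w a) + a * e).
    { apply (Rmult_lt_compat_r e) in Hb; [|lra]. unfold Rdiv in Hb.
      rewrite Rmult_assoc, Rinv_l, Rmult_1_r in Hb; lra. }
    pose proof (Rle_abs (- (b - a))) as Hab. rewrite Rabs_Ropp in Hab.
    assert (- (b - a) * e <= Rabs (b - a) * e) by (apply Rmult_le_compat_r; lra).
    assert (w a - v = e) by (unfold v; ring).
    nra. }
  destruct Hup as [d1 [Hd1 Hup]]. destruct Hdown as [d2 [Hd2 Hdown]].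
  exists (mkposreal _ (Rmin_glb_lt _ _ _ Hd1 Hd2)). intros b Hb.
  change (Rabs (b - a) < Rmin d1 d2) in Hb.
  pose proof (Rmin_l d1 d2). pose proof (Rmin_r d1 d2).
  specialize (Hup b ltac:(lra)). specialize (Hdown b ltac:(lra)).
  apply Rabs_lt_between. lra. }
exists w. split; [exact Hw1|]. split; [exact Hcont|].
intros a. apply is_derive_Reals. intros eps Heps.
destruct (proj1 (filterlim_R (locally a) _ _) (Hcont a) eps Heps) as [d Hd].
exists d. intros h Hh0 Hh.
assert (Hd' : Rabs (w (a + h) - w a) < eps).
{ apply Hd. change (Rabs (a + h - a) < d). now replace (a + h - a) with h by ring. }
pose proof (Hw3 a (w (a + h)) (Hw1 _)) as H1.
pose proof (Hw3 (a + h) (w a) (Hw1 _)) as H2.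
rewrite !Hw2.
set (q := _ / h).
assert (Hq : q * h = L (w (a + h)) - (a + h) * w (a + h) - (L (w a) - a * w a))
  by (unfold q; field; exact Hh0).
clearbody q. apply Rabs_lt_between in Hd'. apply Rabs_lt_between.
destruct (Rlt_le_dec 0 h).
- assert (- w (a + h) <= q <= - w a); [|lra].
  split; apply (Rmult_le_reg_r h); lra.
- assert (- w a <= q <= - w (a + h)); [|lra].
  split; apply (Rmult_le_reg_r (- h)); lra.
Qed.

(** * Limits of grid functions *)

Lemma exp_monotone (x y : R) : x <= y -> exp x <= exp y.
Proof. intros [H| ->]; [left; now apply exp_increasing|lra]. Qed.

(** Discrete Gronwall: each step multiplies [1 + g] by at most [1 + K * h], which is at most
    [exp (K * h)]. *)
Lemma discrete_growth (h K : R) (g : nat -> R) (m k : nat) :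
  0 < h -> 0 <= K -> (forall i, 0 <= g i) ->
  (forall i, (m <= i < m + k)%nat -> g (S i) <= g i + h * (K * (1 + g i))) ->
  1 + g (m + k)%nat <= exp (K * (h * INR k)) * (1 + g m).
Proof.
intros Hh HK Hg. induction k as [|k IH]; intros H.
- rewrite Nat.add_0_r. simpl. rewrite !Rmult_0_r, exp_0. lra.
- specialize (IH ltac:(intros; apply H; lia)).
  specialize (H (m + k)%nat ltac:(lia)).
  rewrite Nat.add_succ_r, S_INR.
  replace (K * (h * (INR k + 1))) with (K * h + K * (h * INR k)) by ring.
  rewrite exp_plus, Rmult_assoc.
  pose proof (exp_ineq1_le (K * h)). pose proof (Hg (m + k)%nat).
  assert (0 <= K * h) by nra.
  apply Rle_trans with ((1 + K * h) * (1 + g (m + k)%nat)); [nra|].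
  apply Rmult_le_compat; lra.
Qed.

(** The exponential is the Gronwall factor over a length [X]; [4 * T / d] bounds the mean slope of a
    function with values in [[0, T]] over a length at least [d / 4]. *)
Definition slope_bound (K X T d : R) : R := exp (K * X) * (4 * T / d + 1).

(* A slope that is large at [x_j >= d] was already large on all of [[d/2, d]],
   which is incompatible with the bound [T] on [f]. *)
Lemma slope_le_slope_bound (h K X T d : R) (N : nat) (f g : nat -> R) :
  0 < h -> h * INR N = X -> 0 < d -> h <= d / 4 -> 0 <= K ->
  (forall i, f (S i) = f i + h * g i) ->
  (forall i, 0 <= f i) -> (forall i, 0 <= g i) -> f N = T ->
  (forall i, (i < N)%nat -> d / 2 <= h * INR i -> g (S i) <= g i + h * (K * (1 + g i))) ->
  forall j, (j <= N)%nat -> d <= h * INR j -> g j <= slope_bound K X T d.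
Proof.
intros Hh HN Hd Hhd HK Hf Hf0 Hg0 HT Hg j Hj Hdj.
destruct (nfloor_ex (d / (2 * h))) as [m0 Hm0]; [apply Rdiv_le_0_compat; lra|].
(* The first node strictly beyond [d / 2]; since [h <= d / 4] it lies at most at [3 * d / 4], which
   leaves a length [d / 4] before node [j]. *)
set (m := S m0).
assert (Hm : d / 2 <= h * INR m <= 3 * d / 4).
{ unfold m. rewrite S_INR.
  assert (h * (d / (2 * h)) = d / 2) by (field; lra). nra. }
assert (Hmj : (m <= j)%nat).
{ apply INR_le. apply (Rmult_le_reg_l h); lra. }
assert (HINR : forall i k, (i <= k)%nat -> h * INR i <= h * INR k).
{ intros i k Hik. apply Rmult_le_compat_l; [lra|now apply le_INR]. }
set (E := exp (K * X)).
assert (HE : 0 < E) by apply exp_pos.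
assert (Hlow : forall i, (m <= i <= j)%nat -> 1 + g j <= E * (1 + g i)).
{ intros i Hi. replace j with (i + (j - i))%nat by lia.
  eapply Rle_trans; [apply (discrete_growth h K g i (j - i) Hh HK Hg0)|].
  - intros k Hk. apply Hg; [lia|]. specialize (HINR m k ltac:(lia)). lra.
  - specialize (Hg0 i). apply Rmult_le_compat_r; [lra|].
    apply exp_monotone, Rmult_le_compat_l; [exact HK|].
    rewrite <- HN. apply HINR. lia. }
(* Summing the increments of [f] turns a large slope at [j] into a large growth of [f] between [m]
   and [j]. *)
assert (Hsum : forall k, (m + k <= j)%nat ->
  h * INR k * ((1 + g j) / E - 1) <= f (m + k)%nat - f m).
{ induction k as [|k IH]; intros Hk.
  - rewrite Nat.add_0_r. simpl. lra.
  - specialize (IH ltac:(lia)). specialize (Hlow (m + k)%nat ltac:(lia)).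
    rewrite Nat.add_succ_r, Hf, S_INR.
    assert ((1 + g j) / E <= 1 + g (m + k)%nat).
    { apply (Rmult_le_reg_l E); [exact HE|]. unfold Rdiv.
      rewrite <- Rmult_assoc, (Rmult_comm E), Rmult_assoc, Rinv_r, Rmult_1_r; lra. }
    nra. }
specialize (Hsum (j - m)%nat ltac:(lia)).
replace (m + (j - m))%nat with j in Hsum by lia.
assert (HfT : f j <= T).
{ rewrite <- HT. clear - Hj Hf Hg0 Hh. induction N as [|N IH].
  - replace j with 0%nat by lia. lra.
  - destruct (Nat.eq_dec j (S N)) as [->|]; [lra|].
    rewrite Hf. specialize (IH ltac:(lia)). specialize (Hg0 N). nra. }
assert (Hlen : d / 4 <= h * INR (j - m)).
{ rewrite minus_INR by exact Hmj. lra. }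
specialize (Hf0 m) as Hfm. specialize (Hg0 j) as Hgj. specialize (Hf0 j) as Hfj.
unfold slope_bound. fold E.
assert (HTd : (1 + g j) / E - 1 <= 4 * T / d).
{ apply Rnot_lt_le. intros Hlt.
  assert (0 <= 4 * T / d) by (apply Rdiv_le_0_compat; lra).
  assert (d / 4 * (4 * T / d) = T) by (field; lra).
  assert (d / 4 * ((1 + g j) / E - 1) <= h * INR (j - m) * ((1 + g j) / E - 1)).
  { apply Rmult_le_compat_r; lra. }
  nra. }
assert (E * ((1 + g j) / E) = 1 + g j) by (field; lra). nra.
Qed.

Section Grid.
Context (U : (nat -> Prop) -> Prop) (PU : ProperFilter U)
  (HU : forall P, U P \/ U (fun n => ~ P n)) (HUe : filter_le U eventually).
Context (X : R) (HX : 0 < X).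

(** The grid of rank [n] has [S n] steps, so the denominator is never 0 and the node of index [S n]
    is [X]. *)
Definition mesh (n : nat) : R := X / INR (S n).

Definition node (t : nat * nat) : R := mesh (fst t) * INR (snd t).

Definition shift (t : nat * nat) : nat * nat := (fst t, S (snd t)).

(* Convergence of a grid function [f (n, i)] along [near_node x] is convergence of
   its interpolations at every sequence of nodes tending to [x], along the ultrafilter. *)
Definition near_node (x : R) (P : nat * nat -> Prop) : Prop :=
  exists eta, 0 < eta /\
    U (fun n => forall i, (i <= n)%nat -> Rabs (node (n, i) - x) < eta -> P (n, i)).

Definition on_interval (x : R) : Prop := 0 < x <= X.

Lemma mesh_pos (n : nat) : 0 < mesh n.
Proof. apply Rdiv_lt_0_compat; [exact HX|apply lt_0_INR; lia]. Qed.

Lemma mesh_last (n : nat) : mesh n * INR (S n) = X.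
Proof. unfold mesh. field. apply not_0_INR. lia. Qed.

Lemma mesh_small (e : R) : 0 < e -> U (fun n => mesh n < e).
Proof.
intros He.
generalize (proj1 (filterlim_R U _ _) (filterlim_div_INR U X (filter_filter (ProperFilter := PU)) HUe) e He).
apply filter_imp. intros n Hn. apply Rabs_lt_between in Hn. fold (mesh n) in Hn. lra.
Qed.

#[local] Instance near_node_filter (x : R) : Filter (near_node x).
Proof.
pose proof (@filter_filter _ _ PU) as FU. split.
- exists 1. split; [lra|]. now apply filter_forall.
- intros P Q [e1 [He1 H1]] [e2 [He2 H2]].
  exists (Rmin e1 e2). split; [now apply Rmin_glb_lt|].
  generalize (filter_and _ _ H1 H2). apply filter_imp.
  intros n [A1 A2] i Hi Hn. pose proof (Rmin_l e1 e2). pose proof (Rmin_r e1 e2).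
  split; [apply A1|apply A2]; auto; lra.
- intros P Q HPQ [e [He H]]. exists e. split; [exact He|].
  revert H. apply filter_imp. auto.
Qed.

(** The index stays at most [n], as [near_node] requires, so that its successor is still on the
    grid; at [X] itself the node of index [n] is taken. *)
Lemma nearest_node (n : nat) (x : R) : on_interval x ->
  exists i, (i <= n)%nat /\ Rabs (node (n, i) - x) <= mesh n.
Proof.
intros Hx. pose proof (mesh_pos n) as Hh. pose proof (mesh_last n) as Hl. unfold node. cbn [fst snd].
destruct (nfloor_ex (x / mesh n)) as [i Hi].
{ apply Rdiv_le_0_compat; unfold on_interval in Hx; lra. }
assert (Hxe : mesh n * (x / mesh n) = x) by (field; lra).
assert (H1 : mesh n * INR i <= x < mesh n * INR i + mesh n) by nra.
destruct (Nat.le_gt_cases i n) as [Hin|Hin].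
- exists i. split; [exact Hin|]. apply Rabs_le_between. lra.
- exists n. split; [lia|]. unfold on_interval in Hx.
  apply le_INR in Hin. rewrite S_INR in *. apply Rabs_le_between. nra.
Qed.

#[local] Instance near_node_proper (x : R) : on_interval x -> ProperFilter (near_node x).
Proof.
intros Hx. split; [|apply near_node_filter].
intros P [e [He H]].
destruct (filter_ex _ (filter_and _ _ H (mesh_small e He))) as [n [Hn Hm]].
destruct (nearest_node n x Hx) as [i [Hi Hi']].
exists (n, i). apply Hn; [exact Hi|lra].
Qed.

Lemma near_node_close (x e : R) : 0 < e ->
  near_node x (fun t => Rabs (node t - x) < e /\ mesh (fst t) < e /\ (snd t <= fst t)%nat).
Proof.
intros He. exists e. split; [exact He|].
generalize (mesh_small e He). apply filter_imp. auto.
Qed.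

Lemma filterlim_node (x : R) : filterlim node (near_node x) (locally x).
Proof.
apply filterlim_R; [apply near_node_filter|]. intros e He.
generalize (near_node_close x e He). apply filter_imp. tauto.
Qed.

Lemma filterlim_mesh (x : R) : filterlim (fun t => mesh (fst t)) (near_node x) (locally 0).
Proof.
apply filterlim_R; [apply near_node_filter|]. intros e He.
generalize (near_node_close x e He). apply filter_imp. intros t Ht.
pose proof (mesh_pos (fst t)). apply Rabs_lt_between. lra.
Qed.

(** The shift changes [f] by the mesh times the bounded [g], which tends to 0; values at consecutive
    nodes are thus interchangeable in the limit. *)
Lemma filterlim_shift (f g : nat * nat -> R) (x l K : R) :
  (forall t, f (shift t) = f t + mesh (fst t) * g t) ->
  near_node x (fun t => Rabs (g t) <= K) ->
  filterlim f (near_node x) (locally l) ->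
  filterlim (fun t => f (shift t)) (near_node x) (locally l).
Proof.
intros Hf HK Hl. apply filterlim_R; [apply near_node_filter|]. intros e He.
assert (HK0 : 0 < Rabs K + 1) by (pose proof (Rabs_pos K); lra).
pose proof (proj1 (filterlim_R _ _ _) Hl (e / 2) ltac:(lra)) as H1.
assert (He' : 0 < e / 2 / (Rabs K + 1)) by (apply Rdiv_lt_0_compat; lra).
pose proof (proj1 (filterlim_R _ _ _) (filterlim_mesh x) _ He') as H2.
generalize (filter_and _ _ HK (filter_and _ _ H1 H2)). apply filter_imp.
intros t [Ht [Ht1 Ht2]]. rewrite Hf. rewrite Rminus_0_r in Ht2.
pose proof (mesh_pos (fst t)) as Hm. rewrite Rabs_pos_eq in Ht2 by lra.
pose proof (Rle_abs K). set (m := mesh (fst t)) in *.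
assert (Hmk : m * (Rabs K + 1) < e / 2).
{ apply (Rmult_lt_compat_r _ _ _ HK0) in Ht2.
  replace (e / 2 / (Rabs K + 1) * (Rabs K + 1)) with (e / 2) in Ht2 by (field; lra). exact Ht2. }
assert (Hmg : Rabs (m * g t) < e / 2).
{ rewrite Rabs_mult, (Rabs_pos_eq m) by lra. nra. }
apply Rabs_lt_between in Ht1, Hmg. apply Rabs_lt_between. lra.
Qed.

(** A discrete mean value inequality: the increment of [f] is the sum of the [mesh n * g i], and
    each term is compared with [mesh n * l]. *)
Lemma increment_bound (n : nat) (f g : nat -> R) (l K : R) (j k : nat) :
  (forall i, f (S i) = f i + mesh n * g i) ->
  (forall i, (j <= i < j + k)%nat -> Rabs (g i - l) <= K) ->
  Rabs (f (j + k)%nat - f j - l * (node (n, (j + k)%nat) - node (n, j)))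
    <= K * (node (n, (j + k)%nat) - node (n, j)).
Proof.
intros Hf. unfold node. cbn [fst snd]. induction k as [|k IH]; intros H.
- rewrite Nat.add_0_r, !Rminus_diag, !Rmult_0_r, Rminus_0_r, Rabs_R0. lra.
- specialize (IH ltac:(intros; apply H; lia)). specialize (H (j + k)%nat ltac:(lia)).
  rewrite Nat.add_succ_r, Hf, S_INR. pose proof (mesh_pos n).
  apply Rabs_le_between in IH, H. apply Rabs_le_between. nra.
Qed.

(** Frees the order of the two nodes; [P] is an order-convex set, in practice a ball, on which [g]
    is controlled. *)
Lemma increment_bound_sym (n : nat) (f g : nat -> R) (l K : R) (i j : nat) (P : R -> Prop) :
  (forall x y z, P x -> P y -> x <= z <= y -> P z) ->
  (forall i, f (S i) = f i + mesh n * g i) ->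
  (forall i, (i <= n)%nat -> P (node (n, i)) -> Rabs (g i - l) <= K) ->
  (i <= n)%nat -> (j <= n)%nat -> P (node (n, i)) -> P (node (n, j)) ->
  Rabs (f i - f j - l * (node (n, i) - node (n, j))) <= K * Rabs (node (n, i) - node (n, j)).
Proof.
intros HP Hf Hg.
assert (Hmono : forall a b, (a <= b)%nat -> node (n, a) <= node (n, b)).
{ intros a b Hab. unfold node. cbn [fst snd].
  apply Rmult_le_compat_l; [left; apply mesh_pos|now apply le_INR]. }
assert (Hle : forall a b, (a <= b)%nat -> (b <= n)%nat -> P (node (n, a)) -> P (node (n, b)) ->
  Rabs (f b - f a - l * (node (n, b) - node (n, a))) <= K * (node (n, b) - node (n, a))).
{ intros a b Hab Hb Pa Pb. replace b with (a + (b - a))%nat by lia.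
  apply increment_bound with (g := g); [exact Hf|]. intros k Hk. apply Hg; [lia|].
  apply (HP _ _ _ Pa Pb). split; apply Hmono; lia. }
intros Hi Hj Pi Pj. destruct (Nat.le_ge_cases i j) as [Hij|Hij].
- specialize (Hle i j Hij Hj Pi Pj). specialize (Hmono _ _ Hij).
  rewrite (Rabs_left1 (node (n, i) - _)) by lra.
  rewrite <- Rabs_Ropp. eapply Rle_trans; [|eapply Rle_trans; [apply Hle|lra]].
  right. f_equal. ring.
- specialize (Hle j i Hij Hi Pj Pi). specialize (Hmono _ _ Hij).
  rewrite (Rabs_pos_eq (node (n, i) - _)) by lra. exact Hle.
Qed.

Lemma ball_convex (x e : R) : forall a b z,
  Rabs (a - x) < e -> Rabs (b - x) < e -> a <= z <= b -> Rabs (z - x) < e.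
Proof.
intros a b z Ha Hb Hz. apply Rabs_lt_between in Ha, Hb. apply Rabs_lt_between. lra.
Qed.

(** Transfers limits along [near_node x] to limits of ordinary sequences along [U]. *)
Lemma nodes_near (x : R) : on_interval x ->
  exists k : nat -> nat, (forall n, (k n <= n)%nat) /\
    filterlim (fun n => (n, k n)) U (near_node x).
Proof.
intros Hx.
set (k := fun n => proj1_sig (constructive_indefinite_description _ (nearest_node n x Hx))).
assert (Hk := fun n => proj2_sig (constructive_indefinite_description _ (nearest_node n x Hx))).
cbv beta in Hk. fold k in Hk.
exists k. split; [intros n; apply (Hk n)|].
intros P [e [He H]]. unfold filtermap.
generalize (filter_and _ _ H (mesh_small e He)). apply filter_imp.
intros n [H1 H2]. destruct (Hk n) as [Hk1 Hk2]. fold (k n) in Hk1, Hk2.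
apply H1; [exact Hk1|lra].
Qed.

(** An ultralimit exists along one sequence of nodes tending to [x]; the bound on the difference
    quotients [g] makes [f] equicontinuous, so all nearby nodes share that limit. *)
Lemma grid_limit_exists (f g : nat * nat -> R) (x K1 K2 : R) : on_interval x ->
  (forall t, f (shift t) = f t + mesh (fst t) * g t) ->
  near_node x (fun t => Rabs (f t) <= K1) ->
  near_node x (fun t => Rabs (g t) <= K2) ->
  exists l : R, filterlim f (near_node x) (locally l).
Proof.
intros Hx Hf HK1 HK2.
destruct (nodes_near x Hx) as [k [Hkn Hk]].
destruct (ultralimit_exists U (fun n => f (n, k n)) K1 PU HU) as [l Hl].
{ exact (Hk _ HK1). }
exists l. apply filterlim_R; [apply near_node_filter|]. intros e He.
destruct HK2 as [eta [Heta HK2]].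
assert (HK0 : 0 < Rabs K2 + 1) by (pose proof (Rabs_pos K2); lra).
(* Two nodes within [d] of [x] are at distance at most [2 * d], and
   [2 * d * (Rabs K2 + 1) = e / 2]. *)
set (d := e / 2 / (Rabs K2 + 1) / 2).
assert (Hd : 0 < d) by (unfold d; repeat apply Rdiv_lt_0_compat; lra).
set (d' := Rmin eta d).
assert (Hd' : 0 < d') by now apply Rmin_glb_lt.
exists d'. split; [exact Hd'|].
assert (Hkd : U (fun n => Rabs (node (n, k n) - x) < d')).
{ generalize (Hk _ (near_node_close x d' Hd')). unfold filtermap. apply filter_imp. tauto. }
generalize (filter_and _ _ HK2 (filter_and _ _ Hkd
  (proj1 (filterlim_R U _ _) Hl (e / 2) ltac:(lra)))).
apply filter_imp. intros n [H1 [Hk2 H3]] i Hi Hn.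
pose proof (Hkn n) as Hk1.
pose proof (Rmin_l eta d) as Hm1. pose proof (Rmin_r eta d) as Hm2. fold d' in Hm1, Hm2.
pose proof (increment_bound_sym n (fun i => f (n, i)) (fun i => g (n, i)) 0 K2 i (k n)
  (fun z => Rabs (z - x) < eta) (ball_convex x eta) (fun i => Hf (n, i))) as HI.
cbv beta in HI.
specialize (HI ltac:(intros j Hj Hj'; rewrite Rminus_0_r; now apply H1)).
specialize (HI Hi Hk1 ltac:(lra) ltac:(lra)).
rewrite Rmult_0_l, Rminus_0_r in HI.
assert (Hdist : Rabs (node (n, i) - node (n, k n)) <= 2 * d).
{ apply Rabs_lt_between in Hn. apply Rabs_lt_between in Hk2. apply Rabs_le_between. lra. }
assert (2 * d * (Rabs K2 + 1) = e / 2) by (unfold d; field; lra).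
pose proof (Rle_abs K2). pose proof (Rabs_pos (node (n, i) - node (n, k n))).
assert (Hfd : Rabs (f (n, i) - f (n, k n)) <= e / 2) by nra.
apply Rabs_lt_between in H3. apply Rabs_le_between in Hfd. apply Rabs_lt_between. lra.
Qed.

Lemma grid_limit_close (f : nat * nat -> R) (y l m e : R) : on_interval y ->
  filterlim f (near_node y) (locally m) ->
  near_node y (fun t => Rabs (f t - l) < e) -> Rabs (m - l) <= e.
Proof.
intros Hy Hm He. pose proof (near_node_proper y Hy) as PN.
apply Rabs_le_between. split.
- apply (filterlim_R_le (F := near_node y) (fun _ => - e) (fun t => f t - l)).
  + revert He. apply filter_imp. intros t Ht. apply Rabs_lt_between in Ht. lra.
  + apply filterlim_const.
  + apply filterlim_Rminus; [exact Hm|apply filterlim_const].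
- apply (filterlim_R_le (F := near_node y) (fun t => f t - l) (fun _ => e)).
  + revert He. apply filter_imp. intros t Ht. apply Rabs_lt_between in Ht. lra.
  + apply filterlim_Rminus; [exact Hm|apply filterlim_const].
  + apply filterlim_const.
Qed.

Lemma near_node_open (x : R) (P : nat * nat -> Prop) :
  near_node x P -> exists d, 0 < d /\ forall y, Rabs (y - x) < d -> near_node y P.
Proof.
intros [e [He H]]. exists (e / 2). split; [lra|]. intros y Hy.
exists (e / 2). split; [lra|]. revert H. apply filter_imp. intros n Hn i Hi Hi'.
apply Hn; [exact Hi|]. apply Rabs_lt_between in Hy, Hi'. apply Rabs_lt_between. lra.
Qed.

(** Convergence along [near_node x] controls all nodes in a neighbourhood of [x], hence also the
    limits at points [y] close to [x]; continuity comes for free. *)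
Lemma grid_limit_continuous (f : nat * nat -> R) (F : R -> R) :
  (forall x, on_interval x -> filterlim f (near_node x) (locally (F x))) ->
  forall x, on_interval x -> continue_in F on_interval x.
Proof.
intros HF x Hx e He.
pose proof (proj1 (filterlim_R _ _ _) (HF x Hx) (e / 2) ltac:(lra)) as H.
destruct (near_node_open _ _ H) as [d [Hd Hd']].
exists d. split; [exact Hd|]. simpl. unfold Rdist. intros y [[Hy _] Hyx].
pose proof (grid_limit_close f y (F x) (F y) (e / 2) Hy (HF y Hy) (Hd' y Hyx)). lra.
Qed.

(** The discrete mean value inequality is applied between nodes tending to [x] and to [y], with
    slopes within [e / 2] of [G x], and passes to the limit along [U]. *)
Lemma grid_limit_derivative (f g : nat * nat -> R) (F G : R -> R) :
  (forall t, f (shift t) = f t + mesh (fst t) * g t) ->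
  (forall x, on_interval x -> filterlim f (near_node x) (locally (F x))) ->
  (forall x, on_interval x -> filterlim g (near_node x) (locally (G x))) ->
  forall x, on_interval x -> D_in F G on_interval x.
Proof.
intros Hf HF HG x Hx e He.
destruct (proj1 (filterlim_R _ _ _) (HG x Hx) (e / 2) ltac:(lra)) as [d [Hd H]].
exists d. split; [exact Hd|]. simpl. unfold Rdist. intros y [[Hy Hne] Hyx].
assert (Hkey : Rabs (F y - F x - G x * (y - x)) <= e / 2 * Rabs (y - x)).
{ destruct (nodes_near x Hx) as [kx [Hkx Lx]]. destruct (nodes_near y Hy) as [ky [Hky Ly]].
  assert (LN := fun z k (Lk : filterlim (fun n : nat => (n, k n)) U (near_node z)) =>
    filterlim_comp _ _ _ _ _ _ _ _ Lk (filterlim_node z)).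
  pose proof (LN _ _ Lx) as Nx. pose proof (LN _ _ Ly) as Ny. clear LN.
  pose proof (filterlim_comp _ _ _ _ _ _ _ _ Lx (HF x Hx)) as Fx.
  pose proof (filterlim_comp _ _ _ _ _ _ _ _ Ly (HF y Hy)) as Fy.
  pose proof (filterlim_Rminus _ _ _ _ Ny Nx) as Nyx. cbv beta in Nyx.
  apply (filterlim_R_le (F := U)
    (fun n => Rabs (f (n, ky n) - f (n, kx n) - G x * (node (n, ky n) - node (n, kx n))))
    (fun n => e / 2 * Rabs (node (n, ky n) - node (n, kx n)))).
  (* A node closer to [y] than this is still within [d] of [x]. *)
  - assert (Hyd : 0 < d - Rabs (y - x)) by lra.
    assert (Hkx' : U (fun n => Rabs (node (n, kx n) - x) < d)).
    { generalize (Lx _ (near_node_close x d Hd)). unfold filtermap. apply filter_imp. tauto. }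
    assert (Hky' : U (fun n => Rabs (node (n, ky n) - y) < d - Rabs (y - x))).
    { generalize (Ly _ (near_node_close y _ Hyd)). unfold filtermap. apply filter_imp. tauto. }
    generalize (filter_and _ _ H (filter_and _ _ Hkx' Hky')).
    apply filter_imp. intros n [H1 [H2 H3]].
    apply (increment_bound_sym n (fun i => f (n, i)) (fun i => g (n, i)) (G x) (e / 2)
      (ky n) (kx n) (fun z => Rabs (z - x) < d) (ball_convex x d) (fun i => Hf (n, i))); auto.
    + intros i Hi Hi'. left. now apply H1.
    + replace (node (n, ky n) - x) with ((node (n, ky n) - y) + (y - x)) by ring.
      eapply Rle_lt_trans; [apply Rabs_triang|lra].
  - apply (filterlim_continuous Rabs); [apply continuous_Rabs|].
    apply filterlim_Rminus; [exact (filterlim_Rminus _ _ _ _ Fy Fx)|].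
    apply filterlim_Rmult; [apply filterlim_const|exact Nyx].
  - apply filterlim_Rmult; [apply filterlim_const|].
    apply (filterlim_continuous Rabs); [apply continuous_Rabs|exact Nyx]. }
replace ((F y - F x) / (y - x) - G x) with ((F y - F x - G x * (y - x)) / (y - x)) by (field; lra).
unfold Rdiv. rewrite Rabs_mult, Rabs_inv.
assert (Hp : 0 < Rabs (y - x)) by (apply Rabs_pos_lt; lra).
apply Rle_lt_trans with (e / 2 * Rabs (y - x) * / Rabs (y - x)); [|field_simplify; lra].
apply Rmult_le_compat_r; [left; now apply Rinv_0_lt_compat|exact Hkey].
Qed.

(** * Compactness for second-order difference relations degenerate at 0 *)

Section SecondOrder.
Context (f g k : nat * nat -> R) (T C : R) (HC : 0 <= C).
Context (Hf : forall t, f (shift t) = f t + mesh (fst t) * g t).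
Context (Hg : forall t, g (shift t) = g t + mesh (fst t) * k t).
Context (Hf0 : forall t, 0 <= f t) (Hg0 : forall t, 0 <= g t).
Context (HT : forall n, f (n, S n) = T).
Context (Hk : forall t, (snd t <= fst t)%nat ->
  - (C * g (shift t)) <= k t * node (shift t) ^ 2 <= C * (1 + g t)).

Lemma grid_value_le (t : nat * nat) : (snd t <= S (fst t))%nat -> f t <= T.
Proof.
destruct t as [n i]. cbn [fst snd]. intros Hi. rewrite <- (HT n).
induction Hi as [|m Hi IH]; [lra|]. eapply Rle_trans; [exact IH|].
change (n, S m) with (shift (n, m)). rewrite Hf.
pose proof (mesh_pos (fst (n, m))). pose proof (Hg0 (n, m)). nra.
Qed.

(** Away from 0 the weight [node ^ 2] is bounded below, so the upper half of [Hk] becomes the growth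
    condition of [slope_le_slope_bound]. Once the slopes are bounded, both halves of [Hk] bound
    [k]. *)
Lemma grid_slopes_bounded (x : R) : on_interval x ->
  exists K, near_node x (fun t =>
    Rabs (g t) <= K /\ Rabs (g (shift t)) <= K /\ Rabs (k t) <= K).
Proof.
intros Hx. set (d := x / 2). assert (Hd : 0 < d) by (unfold d, on_interval in *; lra).
set (K := C / (d / 2) ^ 2).
assert (Hd2 : 0 < (d / 2) ^ 2) by (apply pow_lt; lra).
assert (HK : 0 <= K) by (apply Rdiv_le_0_compat; lra).
assert (HKk : forall y c b, 0 <= c -> d / 2 <= y -> b * y ^ 2 <= C * c -> b <= K * c).
{ intros y c b Hc Hy Hb. unfold K.
  assert (HKc : 0 <= K * c) by (apply Rmult_le_pos; lra).
  destruct (Rle_lt_dec b 0) as [|Hb0]; [unfold K in HKc; lra|].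
  apply (Rmult_le_reg_r ((d / 2) ^ 2)); [exact Hd2|].
  replace (C / (d / 2) ^ 2 * c * (d / 2) ^ 2) with (C * c) by (field; lra).
  eapply Rle_trans; [|exact Hb]. apply Rmult_le_compat_l; [lra|].
  apply pow_incr; lra. }
set (S0 := slope_bound K X T d).
assert (Hnode : forall n i, node (n, i) <= node (shift (n, i))).
{ intros n i. unfold node, shift. cbn [fst snd]. rewrite S_INR. pose proof (mesh_pos n). lra. }
assert (Hslope : forall n j, mesh n < d / 4 -> (j <= S n)%nat -> d <= node (n, j) -> g (n, j) <= S0).
{ intros n j Hm Hj Hdj.
  apply (slope_le_slope_bound (mesh n) K X T d (S n) (fun i => f (n, i)) (fun i => g (n, i)));
    auto using mesh_pos, mesh_last; try lra.
  - intros i. exact (Hf (n, i)).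
  - intros i Hi Hdi. change (n, S i) with (shift (n, i)). rewrite Hg. cbn [fst].
    apply Rplus_le_compat_l, Rmult_le_compat_l; [left; apply mesh_pos|].
    apply (HKk (node (shift (n, i)))).
    + specialize (Hg0 (n, i)). lra.
    + eapply Rle_trans; [exact Hdi|apply Hnode].
    + apply Hk. cbn [fst snd]. lia. }
exists (Rmax S0 (K * (1 + S0))).
assert (Hd4 : 0 < d / 4) by lra.
generalize (near_node_close x (d / 4) Hd4). apply filter_imp.
intros [n i] [H1 [H2 H3]]. cbn [fst snd] in *.
assert (Hxn : d <= node (n, i)).
{ apply Rabs_lt_between in H1. unfold d in *. lra. }
pose proof (Hnode n i) as Hn.
assert (G1 : g (n, i) <= S0) by (apply Hslope; [exact H2|lia|exact Hxn]).
assert (G2 : g (shift (n, i)) <= S0)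
  by (apply Hslope; [exact H2|simpl; lia|unfold shift in *; cbn [fst snd] in *; lra]).
pose proof (Rmax_l S0 (K * (1 + S0))). pose proof (Rmax_r S0 (K * (1 + S0))).
pose proof (Hg0 (n, i)) as G1'. pose proof (Hg0 (shift (n, i))) as G2'.
rewrite !(Rabs_pos_eq (g _)) by assumption. repeat split; try lra.
destruct (Hk (n, i) H3) as [K1 K2].
apply HKk in K2; [|lra|lra].
assert (K3 : - k (n, i) <= K * g (shift (n, i))).
{ apply (HKk (node (shift (n, i)))); [exact G2'|lra|lra]. }
assert (K * (1 + g (n, i)) <= K * (1 + S0)) by (apply Rmult_le_compat_l; lra).
assert (K * g (shift (n, i)) <= K * (1 + S0)) by (apply Rmult_le_compat_l; lra).
apply Rabs_le_between. lra.
Qed.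

(** Bounded slopes make the values converge, bounded second differences make the slopes converge.
    Shifted limits are included because the scheme mixes consecutive nodes. *)
Lemma second_order_grid_limit :
  exists F G : R -> R, (forall x, on_interval x ->
    filterlim f (near_node x) (locally (F x)) /\
    filterlim (fun t => f (shift t)) (near_node x) (locally (F x)) /\
    filterlim g (near_node x) (locally (G x)) /\
    filterlim (fun t => g (shift t)) (near_node x) (locally (G x))) /\
  F X = T.
Proof.
assert (HfT : forall x, near_node x (fun t => Rabs (f t) <= T)).
{ intros x. generalize (near_node_close x 1 Rlt_0_1). apply filter_imp.
  intros t [_ [_ Ht]]. rewrite Rabs_pos_eq by apply Hf0. apply grid_value_le. lia. }
assert (HF : forall x, exists l : R, on_interval x -> filterlim f (near_node x) (locally l)).
{ intros x. destruct (classic (on_interval x)) as [Hx|Hx]; [|exists 0; tauto].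
  destruct (grid_slopes_bounded x Hx) as [K HK].
  destruct (grid_limit_exists f g x T K Hx Hf (HfT x)) as [l Hl]; [|now exists l].
  revert HK. apply filter_imp. tauto. }
assert (HG : forall x, exists l : R, on_interval x -> filterlim g (near_node x) (locally l)).
{ intros x. destruct (classic (on_interval x)) as [Hx|Hx]; [|exists 0; tauto].
  destruct (grid_slopes_bounded x Hx) as [K HK].
  destruct (grid_limit_exists g k x K K Hx Hg) as [l Hl]; [| |now exists l];
    revert HK; apply filter_imp; tauto. }
set (F := fun x => proj1_sig (constructive_indefinite_description _ (HF x))).
set (G := fun x => proj1_sig (constructive_indefinite_description _ (HG x))).
assert (LF : forall x, on_interval x -> filterlim f (near_node x) (locally (F x)))
  by (intros x; exact (proj2_sig (constructive_indefinite_description _ (HF x)))).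
assert (LG : forall x, on_interval x -> filterlim g (near_node x) (locally (G x)))
  by (intros x; exact (proj2_sig (constructive_indefinite_description _ (HG x)))).
clearbody F G.
assert (LF' : forall x, on_interval x -> filterlim (fun t => f (shift t)) (near_node x) (locally (F x))).
{ intros x Hx. destruct (grid_slopes_bounded x Hx) as [K HK].
  apply (filterlim_shift f g x (F x) K Hf); [|now apply LF].
  revert HK. apply filter_imp. tauto. }
exists F, G. split.
- intros x Hx. split; [now apply LF|]. split; [now apply LF'|]. split; [now apply LG|].
  destruct (grid_slopes_bounded x Hx) as [K HK].
  apply (filterlim_shift g k x (G x) K Hg); [|now apply LG].
  revert HK. apply filter_imp. tauto.
- assert (HX' : on_interval X) by (unfold on_interval; lra).
  (* The boundary node has index [S n], which [near_node] excludes; it is reached as the shift of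
     [(n, n)]. *)
  assert (Hlast : filterlim (fun n => (n, n)) U (near_node X)).
  { intros P [e [He H]]. unfold filtermap.
    generalize (filter_and _ _ H (mesh_small e He)). apply filter_imp.
    intros n [H1 H2]. apply H1; [lia|].
    pose proof (mesh_last n) as Hl. pose proof (mesh_pos n). rewrite S_INR in Hl.
    unfold node. cbn [fst snd]. apply Rabs_lt_between. lra. }
  pose proof (filterlim_comp _ _ _ _ _ _ _ _ Hlast (LF' X HX')) as L1.
  apply (filterlim_locally_unique (F := U) (fun n : nat => T) (F X) T).
  + apply (filterlim_ext (fun n => f (shift (n, n)))); [intros n; apply HT|exact L1].
  + apply filterlim_const.
Qed.
End SecondOrder.
End Grid.

(** * Differential inequalities degenerate at 0 *)

Section SingularInequality.
Context (X s k C : R) (HX : 0 < X) (Hs : 0 < s) (Hk : 0 < k) (HC : 0 <= C).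
Context (f f' f'' : R -> R).
Let D (x : R) : Prop := 0 < x <= X.
Context (Hf : forall x, D x -> D_in f f' D x) (Hf' : forall x, D x -> D_in f' f'' D x).
Context (f_ge0 : forall x, D x -> 0 <= f x) (f'_ge0 : forall x, D x -> 0 <= f' x).
Context (Hlow : forall x, D x -> k * f x <= s * x ^ 2 * f'' x + C * x * f' x).
Context (Hup : forall x, D x -> x ^ 2 * f'' x <= C * (f x + f' x)).

Lemma singular_nondecreasing (x y : R) : 0 < x -> x <= y -> y <= X -> f x <= f y.
Proof.
intros Hx Hxy Hy. apply (D_in_nondecreasing f f' D); [exact Hxy|].
intros u Hu. assert (D u) by (unfold D; lra). auto.
Qed.

(* If [f >= e > 0], the inequality [Hlow], divided by [x], makes
   [s x f' + C f - k e ln x] nondecreasing, but this tends to [+oo] at 0. *)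
Lemma singular_vanishes_at_0 (e : R) : 0 < e ->
  exists d, 0 < d /\ forall x, D x -> x < d -> f x < e.
Proof.
(* As [f] is nondecreasing, one value below [e] settles the matter; otherwise [f >= e]
   throughout. *)
intros He. destruct (classic (exists x0, D x0 /\ f x0 < e)) as [[x0 [Hx0 Hfx0]]|Hno].
{ exists x0. split; [apply Hx0|]. intros x Hx Hlt.
  pose proof (singular_nondecreasing x x0 (proj1 Hx) ltac:(lra) (proj2 Hx0)). lra. }
exfalso.
assert (Hfe : forall x, D x -> e <= f x).
{ intros x Hx. apply Rnot_lt_le. intros Hlt. apply Hno. now exists x. }
set (g := fun x => s * (x * f' x) + C * f x + - (k * e) * ln x).
assert (Hg : forall x, D x -> g x <= g X).
{ intros x Hx. apply (D_in_nondecreasing g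
    (fun x => s * (1 * f' x + x * f'' x) + C * f' x + - (k * e) * / x) D); [apply Hx|].
  intros u Hu. assert (Du : D u) by (unfold D in *; lra).
  split; [exact Du|]. split.
  - apply (Dadd D). 2: apply (Dmult_const D ln Rinv).
    2:{ apply is_derive_D_in, is_derive_ln. apply Du. }
    apply (Dadd D); apply (Dmult_const D); [|now apply Hf].
    apply (Dmult D (fun _ => 1) f'' (fun x => x) f'); [apply Dx|now apply Hf'].
  - specialize (Hlow u Du). specialize (Hfe u Du). specialize (f'_ge0 u Du).
    destruct Du as [Du _].
    apply (Rmult_le_reg_r u); [exact Du|].
    replace ((s * (1 * f' u + u * f'' u) + C * f' u + - (k * e) * / u) * u)
      with (s * u * f' u + (s * u ^ 2 * f'' u + C * u * f' u) - k * e) by (field; lra).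
    assert (k * e <= k * f u) by (apply Rmult_le_compat_l; lra).
    assert (0 <= s * u * f' u) by (apply Rmult_le_pos; [nra|exact f'_ge0]).
    lra. }
(* Chosen so that [- (k * e) * ln y] is at least [Rabs (g X) + 1], which contradicts
   [g y <= g X]. *)
set (y := Rmin X (exp (- (Rabs (g X) + 1) / (k * e)))).
assert (Hke : 0 < k * e) by (apply Rmult_lt_0_compat; lra).
assert (Dy : D y).
{ unfold D, y. split; [apply Rmin_glb_lt; [exact HX|apply exp_pos]|apply Rmin_l]. }
specialize (Hg y Dy). pose proof (f_ge0 y Dy). pose proof (f'_ge0 y Dy).
assert (Hly : ln y <= - (Rabs (g X) + 1) / (k * e)).
{ rewrite <- (ln_exp (_ / _)). destruct (Rmin_r X (exp (- (Rabs (g X) + 1) / (k * e)))) as [H1|H1].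
  - left. apply ln_increasing; [apply Dy|exact H1].
  - right. f_equal. exact H1. }
assert (Rabs (g X) + 1 <= - (k * e) * ln y).
{ apply (Rmult_le_compat_l (k * e)) in Hly; [|lra].
  replace (k * e * (- (Rabs (g X) + 1) / (k * e))) with (- (Rabs (g X) + 1)) in Hly by (field; lra).
  lra. }
pose proof (Rle_abs (g X)).
assert (0 <= s * (y * f' y)).
{ destruct Dy. apply Rmult_le_pos; [lra|]. apply Rmult_le_pos; lra. }
assert (0 <= C * f y) by (apply Rmult_le_pos; lra).
unfold g at 1 in Hg. lra.
Qed.

(** Gronwall on [[z, X]]: there [Hup] gives [f' + f'' <= K * (f + f')], so
    [exp (- K * x) * (f + f')] is nonincreasing and nonnegative, and stays 0 after [z]. *)
Lemma singular_unique_continuation (z : R) : D z -> f z = 0 -> f' z = 0 -> f X = 0.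
Proof.
intros Dz E1 E2.
assert (Hz2 : 0 < z ^ 2) by (apply pow_lt, Dz).
set (K := 1 + C / z ^ 2).
assert (H : - (exp (- K * z) * (f z + f' z)) <= - (exp (- K * X) * (f X + f' X))).
{ apply (D_in_nondecreasing (fun x => - (exp (- K * x) * (f x + f' x)))
    (fun x => - ((- K * exp (- K * x)) * (f x + f' x) + exp (- K * x) * (f' x + f'' x))) D);
    [apply Dz|].
  intros u Hu. assert (Du : D u) by (unfold D in *; lra).
  split; [exact Du|]. split.
  - apply (Dopp D), (Dmult D); [|apply (Dadd D); auto].
    apply is_derive_D_in. auto_derive; [exact I|ring].
  - specialize (Hup u Du). specialize (f_ge0 u Du). specialize (f'_ge0 u Du).
    assert (Hz : 0 < z) by apply Dz.
    assert (f'' u <= C / z ^ 2 * (f u + f' u)).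
    { assert (0 <= C / z ^ 2 * (f u + f' u)).
      { apply Rmult_le_pos; [|lra]. apply Rdiv_le_0_compat; lra. }
      destruct (Rle_lt_dec (f'' u) 0); [lra|].
      apply (Rmult_le_reg_l (z ^ 2)); [exact Hz2|].
      replace (z ^ 2 * (C / z ^ 2 * (f u + f' u))) with (C * (f u + f' u)) by (field; lra).
      eapply Rle_trans; [|exact Hup]. apply Rmult_le_compat_r; [lra|].
      apply pow_incr; lra. }
    assert (0 <= exp (- K * u) * (K * (f u + f' u) - f' u - f'' u)); [|lra].
    apply Rmult_le_pos; [left; apply exp_pos|]. unfold K. lra. }
rewrite E1, E2, Rplus_0_l, Rmult_0_r, Ropp_0 in H.
pose proof (exp_pos (- K * X)) as HE.
assert (DX : D X) by (unfold D; lra).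
specialize (f_ge0 X DX). specialize (f'_ge0 X DX).
assert (Hle : exp (- K * X) * (f X + f' X) <= exp (- K * X) * 0) by lra.
apply Rmult_le_reg_l in Hle; [lra|exact HE].
Qed.

(** On an interval where [f] is constant, [f'] and [f''] vanish, so [Hlow] forces [f = 0] there, and
    unique continuation carries this to [X]. *)
Lemma singular_increasing (x y : R) : 0 < f X -> 0 < x -> x < y -> y <= X -> f x < f y.
Proof.
intros HfX Hx Hxy Hy. apply Rnot_le_lt. intros Hle.
assert (Hconst : forall z, x <= z <= y -> f z = f x).
{ intros z Hz.
  pose proof (singular_nondecreasing x z Hx (proj1 Hz) ltac:(lra)).
  pose proof (singular_nondecreasing z y ltac:(lra) (proj2 Hz) Hy). lra. }
assert (Hder : forall (h h' : R -> R) c, (forall z, D z -> D_in h h' D z) ->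
  (forall z, x < z < y -> h z = c) -> forall z, x < z < y -> h' z = 0).
{ intros h h' c Hh Hc z Hz. rewrite <- (Derive_const c z). symmetry. apply is_derive_unique.
  apply (is_derive_ext_loc h).
  - apply (locally_interval _ z x y); simpl; try lra. intros t H1 H2. apply Hc. lra.
  - apply (D_in_is_derive h h' D); [|apply Hh; unfold D; lra].
    apply (locally_interval _ z x y); simpl; try lra. intros t H1 H2. unfold D. lra. }
assert (H' : forall z, x < z < y -> f' z = 0)
  by (apply (Hder f f' (f x)); [exact Hf|intros; apply Hconst; lra]).
assert (H'' : forall z, x < z < y -> f'' z = 0) by (apply (Hder f' f'' 0); assumption).
set (z := (x + y) / 2). assert (Hz : x < z < y) by (unfold z; lra).
assert (Dz : D z) by (unfold D; lra).
specialize (Hlow z Dz). rewrite (H' z Hz), (H'' z Hz) in Hlow.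
assert (f z = 0); [|pose proof (singular_unique_continuation z Dz H (H' z Hz)); lra].
specialize (f_ge0 z Dz). nra.
Qed.
End SingularInequality.

(** * Extension to the closed interval *)

Lemma D_in_ext_on (f g f' : R -> R) (D : R -> Prop) (x : R) :
  D x -> (forall y, D y -> f y = g y) -> D_in f f' D x -> D_in g f' D x.
Proof.
intros Hx E H e He. destruct (H e He) as [d [Hd Hd']]. exists d. split; [exact Hd|].
intros y Hy. simpl in *. rewrite <- !E by (assumption || apply Hy). now apply Hd'.
Qed.

(** The equations live on []0, X]]; the boundary value [l] at 0 is attached afterwards, the second
    hypothesis being its attainment as a limit. *)
Lemma extend_by_0_continuous (f : R -> R) (X l : R) :
  (forall x, 0 < x <= X -> continue_in f (fun x => 0 < x <= X) x) ->
  (forall e, 0 < e -> exists d, 0 < d /\ forall x, 0 < x <= X -> x < d -> Rabs (f x - l) < e) ->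
  C0_on (fun x => 0 <= x <= X) (fun x => if Rle_dec x 0 then l else f x).
Proof.
intros Hc H0 x Hx e He. destruct (Rle_dec x 0) as [Hx0|Hx0].
- destruct (H0 e He) as [d [Hd Hd']]. exists d. split; [exact Hd|].
  simpl. unfold Rdist. intros y [[Hy _] Hyx]. destruct (Rle_dec y 0).
  + now rewrite Rminus_diag, Rabs_R0.
  + apply Hd'; [lra|]. apply Rabs_lt_between in Hyx. lra.
- destruct (Hc x ltac:(lra) e He) as [d [Hd Hd']].
  exists (Rmin d x). split; [apply Rmin_glb_lt; lra|].
  simpl in *. unfold Rdist in *. intros y [[Hy Hne] Hyx].
  pose proof (Rmin_l d x). pose proof (Rmin_r d x).
  destruct (Rle_dec y 0).
  + apply Rabs_lt_between in Hyx. lra.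
  + apply Hd'. split; [split; [lra|exact Hne]|lra].
Qed.

(** * The difference scheme *)

Lemma continuous_clip (lo : R) (q : R) :
  continuous (fun q => Rmin 1 (Rmax lo (1 - q))) q.
Proof.
apply (filterlim_R (locally q)). intros eps Heps.
exists (mkposreal eps Heps). intros y Hy. change (Rabs (y - q) < eps) in Hy.
revert Hy. unfold Rmin, Rmax. repeat destruct Rle_dec; intros Hy;
  apply Rabs_lt_between in Hy; apply Rabs_lt_between; lra.
Qed.

Record state := State { val : R; val_slope : R; gap : R; gap_slope : R }.

Section Scheme.
Context (M om : R -> R) (r la mu sg th : R).
Context (Hr : 0 < r) (Hla : 0 < la) (Hmu : mu < r) (Hsg : 0 < sg) (Hth : 0 < th <= 1).
Context (HM : forall a, 0 <= a -> - a <= M a <= 0) (CM : forall a, continuous M a).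
Context (Hom : forall a, 0 <= om a < 1) (Com : forall a, continuous om a).

(* The truncation bounds the coefficients during the shooting; it is inactive
   on the solution, where [0 <= q <= 1 - th]. *)
Definition clip (q : R) : R := Rmin 1 (Rmax th (1 - q)).

Definition drift (p : R) : R := (la + r) / p - la + sg ^ 2 - mu.

(* Solves [(sg x)^2 / 2 * (g' - g) / h = source - c x g'] for [g']. *)
Definition next_slope (h x c source g : R) : R :=
  (source + (sg * x) ^ 2 / 2 / h * g) / (c * x + (sg * x) ^ 2 / 2 / h).

(** The first equation solved for its second-order term, without the drift. For [v] and [u]
    nonnegative it is nonnegative, since [M <= 0] on nonnegative arguments. *)
Definition val_source (v u q : R) : R := r * v - M (u / clip q).

(** The same for the second equation written in [q = 1 - p]. The minimum contributes
    [- om (u / p) / p] to [H_xi], so its term appears here with a plus sign. *)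
Definition gap_source (u q w : R) : R := (r + la) * q + om (u / clip q) / clip q * w.

(** The sources use the new values and the old slopes; only the drift is implicit, linearly in the
    unknown slope, which [next_slope] solves for. *)
Definition step (h x : R) (s : state) : state :=
  let v := val s + h * val_slope s in
  let q := gap s + h * gap_slope s in
  let c := drift (clip q) in
  State v (next_slope h x c (val_source v (val_slope s) q) (val_slope s))
        q (next_slope h x c (gap_source (val_slope s) q (gap_slope s)) (gap_slope s)).

Fixpoint run (h a b : R) (i : nat) : state :=
  match i with
  | O => State 0 a 0 b
  | S j => step h (h * INR i) (run h a b j)
  end.

Lemma clip_bounds (q : R) : th <= clip q <= 1.
Proof. unfold clip, Rmin, Rmax. repeat destruct Rle_dec; lra. Qed.

(** Positivity comes from [p <= 1]: then [(la + r) / p - la >= r > mu]. *)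
Lemma drift_bounds (p : R) : th <= p <= 1 -> 0 < drift p <= (la + r) / th + sg ^ 2 + la + Rabs mu.
Proof.
intros Hp. unfold drift.
assert (la + r <= (la + r) / p).
{ apply (Rmult_le_reg_r p); [lra|]. unfold Rdiv. rewrite Rmult_assoc, Rinv_l; nra. }
assert ((la + r) / p <= (la + r) / th).
{ apply Rmult_le_compat_l; [lra|]. apply Rinv_le_contravar; lra. }
assert (0 < sg ^ 2) by (apply pow_lt; lra).
pose proof (Rle_abs (- mu)) as Hm. rewrite Rabs_Ropp in Hm. lra.
Qed.

Lemma val_source_bounds (v u q : R) : 0 <= v -> 0 <= u ->
  r * v <= val_source v u q <= r * v + u / th.
Proof.
intros Hv Hu. unfold val_source. pose proof (clip_bounds q) as Hc.
assert (0 <= u / clip q) by (apply Rdiv_le_0_compat; lra).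
assert (u / clip q <= u / th).
{ apply Rmult_le_compat_l; [lra|]. apply Rinv_le_contravar; lra. }
specialize (HM (u / clip q)). lra.
Qed.

Lemma gap_source_bounds (u q w : R) : 0 <= w ->
  (r + la) * q <= gap_source u q w <= (r + la) * q + w / th.
Proof.
intros Hw. unfold gap_source. pose proof (clip_bounds q) as Hc.
specialize (Hom (u / clip q)).
assert (0 <= om (u / clip q) / clip q) by (apply Rdiv_le_0_compat; lra).
assert (om (u / clip q) / clip q <= / th).
{ unfold Rdiv. rewrite <- (Rmult_1_l (/ th)).
  apply Rmult_le_compat; try lra.
  - left. apply Rinv_0_lt_compat. lra.
  - apply Rinv_le_contravar; lra. }
unfold Rdiv at 3. nra.
Qed.

Lemma next_slope_nonneg (h x p src g : R) :
  0 < h -> 0 < x -> th <= p <= 1 -> 0 <= src -> 0 <= g -> 0 <= next_slope h x (drift p) src g.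
Proof.
intros Hh Hx Hp Hs Hg. unfold next_slope.
assert (0 < (sg * x) ^ 2 / 2 / h).
{ apply Rdiv_lt_0_compat; [|lra]. assert (0 < (sg * x) ^ 2); [apply pow_lt; nra|lra]. }
pose proof (drift_bounds p Hp).
apply Rdiv_le_0_compat; nra.
Qed.

(** Recasts the new slope as the old one plus [h] times a second difference, the form in which the
    grid limits consume it; positive drift keeps the denominator nonzero. *)
Lemma next_slope_eq (h x p src g : R) :
  0 < h -> 0 < x -> th <= p <= 1 ->
  next_slope h x (drift p) src g =
  g + h * ((src - drift p * x * next_slope h x (drift p) src g) / ((sg * x) ^ 2 / 2)).
Proof.
intros Hh Hx Hp. unfold next_slope.
assert (0 < (sg * x) ^ 2 / 2) by (assert (0 < (sg * x) ^ 2); [apply pow_lt; nra|lra]).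
set (A := (sg * x) ^ 2 / 2) in *.
pose proof (drift_bounds p Hp). set (c := drift p) in *.
assert (0 < A / h) by (apply Rdiv_lt_0_compat; lra).
assert (0 < c * x) by (apply Rmult_lt_0_compat; lra).
field. repeat split; try lra. nra.
Qed.

(** * Signs, continuity and shooting for the discrete solutions *)

Lemma run_nonneg (h a b : R) (i : nat) : 0 < h -> 0 <= a -> 0 <= b ->
  0 <= val (run h a b i) /\ 0 <= val_slope (run h a b i) /\
  0 <= gap (run h a b i) /\ 0 <= gap_slope (run h a b i).
Proof.
intros Hh Ha Hb. induction i as [|i [IH1 [IH2 [IH3 IH4]]]]; [simpl; lra|].
cbn [run]. set (s := run h a b i) in *. unfold step.
set (v := val s + _). set (q := gap s + _).
cbn [val val_slope gap gap_slope].
assert (Hv : 0 <= v) by (unfold v; nra).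
assert (Hq : 0 <= q) by (unfold q; nra).
assert (0 < h * INR (S i)) by (apply Rmult_lt_0_compat; [lra|apply lt_0_INR; lia]).
pose proof (clip_bounds q).
pose proof (val_source_bounds v (val_slope s) q Hv IH2).
pose proof (gap_source_bounds (val_slope s) q (gap_slope s) IH4).
repeat split; try assumption; apply next_slope_nonneg; auto; nra.
Qed.

(** The edge [a = 0] of the shooting rectangle; it rests on [M 0 = 0], which the bounds on [M]
    force. *)
Lemma run_val_zero (h b : R) (i : nat) :
  val (run h 0 b i) = 0 /\ val_slope (run h 0 b i) = 0.
Proof.
induction i as [|i [IH1 IH2]]; [easy|]. cbn [run]. unfold step.
cbn [val val_slope]. rewrite IH1, IH2. split; [ring|].
unfold next_slope, val_source, Rdiv. rewrite Rmult_0_l.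
replace (M 0) with 0 by (specialize (HM 0); lra). ring.
Qed.

Lemma run_gap_zero (h a : R) (i : nat) :
  gap (run h a 0 i) = 0 /\ gap_slope (run h a 0 i) = 0.
Proof.
induction i as [|i [IH1 IH2]]; [easy|]. cbn [run]. unfold step.
cbn [gap gap_slope]. rewrite IH1, IH2. split; [ring|].
unfold next_slope, gap_source, Rdiv. ring.
Qed.

(** The first step contributes exactly [h * a] and [h * b], and later increments are nonnegative:
    lower bounds free of the coupling, for the far edges of the shooting rectangle. *)
Lemma run_ge_first (h a b : R) (i : nat) : 0 < h -> 0 <= a -> 0 <= b ->
  h * a <= val (run h a b (S i)) /\ h * b <= gap (run h a b (S i)).
Proof.
intros Hh Ha Hb. induction i as [|i [IH1 IH2]]; [simpl; lra|].
destruct (run_nonneg h a b (S i) Hh Ha Hb) as [_ [H1 [_ H2]]].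
change (run h a b (S (S i))) with (step h (h * INR (S (S i))) (run h a b (S i))).
unfold step. cbn [val gap]. nra.
Qed.

Lemma run_continuous (h : R) (i : nat) : 0 < h ->
  forall z : R * R,
    continuous (fun z => val (run h (fst z) (snd z) i)) z /\
    continuous (fun z => val_slope (run h (fst z) (snd z) i)) z /\
    continuous (fun z => gap (run h (fst z) (snd z) i)) z /\
    continuous (fun z => gap_slope (run h (fst z) (snd z) i)) z.
Proof.
intros Hh z. induction i as [|i [IH1 [IH2 [IH3 IH4]]]].
{ repeat split; [apply continuous_const|apply (continuous_fst (fst z) (snd z))
    |apply continuous_const|apply (continuous_snd (fst z) (snd z))]. }
assert (H0 : 0 < h * INR (S i)) by (apply Rmult_lt_0_compat; [lra|apply lt_0_INR; lia]).
set (x := h * INR (S i)) in *.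
unfold continuous in *. cbn [run]. fold x. unfold step. cbn [val val_slope gap gap_slope].
set (s := fun z : R * R => run h (fst z) (snd z) i) in *.
set (v := fun z => val (s z) + h * val_slope (s z)).
set (q := fun z => gap (s z) + h * gap_slope (s z)).
assert (Lv : filterlim v (locally z) (locally (v z))).
{ apply filterlim_Rplus; [exact IH1|]. apply filterlim_Rmult; [apply filterlim_const|exact IH2]. }
assert (Lq : filterlim q (locally z) (locally (q z))).
{ apply filterlim_Rplus; [exact IH3|]. apply filterlim_Rmult; [apply filterlim_const|exact IH4]. }
pose proof (clip_bounds (q z)) as Hc.
assert (Lc : filterlim (fun z => clip (q z)) (locally z) (locally (clip (q z)))).
{ apply (filterlim_continuous clip); [apply continuous_clip|exact Lq]. }
assert (Ld : filterlim (fun z => drift (clip (q z))) (locally z) (locally (drift (clip (q z))))).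
{ unfold drift. repeat first [apply filterlim_Rminus|apply filterlim_Rplus|apply filterlim_const].
  apply filterlim_Rdiv; [lra|apply filterlim_const|exact Lc]. }
assert (La : filterlim (fun z => val_slope (s z) / clip (q z)) (locally z)
  (locally (val_slope (s z) / clip (q z)))).
{ apply filterlim_Rdiv; [lra|exact IH2|exact Lc]. }
assert (Ln : forall src g : R * R -> R, filterlim src (locally z) (locally (src z)) ->
  filterlim g (locally z) (locally (g z)) ->
  filterlim (fun z => next_slope h x (drift (clip (q z))) (src z) (g z)) (locally z)
    (locally (next_slope h x (drift (clip (q z))) (src z) (g z)))).
{ intros src g Ls Lg. unfold next_slope. apply filterlim_Rdiv.
  - pose proof (drift_bounds _ Hc).
    assert (0 < (sg * x) ^ 2 / 2 / h).
    { apply Rdiv_lt_0_compat; [|lra]. assert (0 < (sg * x) ^ 2); [apply pow_lt; nra|lra]. }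
    nra.
  - apply filterlim_Rplus; [exact Ls|]. apply filterlim_Rmult; [apply filterlim_const|exact Lg].
  - apply filterlim_Rplus; [|apply filterlim_const].
    apply filterlim_Rmult; [exact Ld|apply filterlim_const]. }
split; [exact Lv|]. split; [|split; [exact Lq|]].
- apply (Ln (fun z => val_source (v z) (val_slope (s z)) (q z)) (fun z => val_slope (s z)));
    [|exact IH2].
  unfold val_source. apply filterlim_Rminus.
  + apply filterlim_Rmult; [apply filterlim_const|exact Lv].
  + exact (filterlim_continuous M _ _ (CM _) La).
- apply (Ln (fun z => gap_source (val_slope (s z)) (q z) (gap_slope (s z)))
    (fun z => gap_slope (s z))); [|exact IH4].
  unfold gap_source. apply filterlim_Rplus.
  + apply filterlim_Rmult; [apply filterlim_const|exact Lq].
  + apply filterlim_Rmult; [|exact IH4].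
    apply filterlim_Rdiv; [lra| |exact Lc].
    exact (filterlim_continuous om _ _ (Com _) La).
Qed.

Lemma run_shooting (h B : R) (n : nat) : 0 < h -> 0 <= B ->
  exists a b, 0 <= a /\ 0 <= b /\
    val (run h a b (S n)) = B /\ gap (run h a b (S n)) = 1 - th.
Proof.
intros Hh HB.
(* With initial slope [B / h], or [(1 - th) / h] for the gap, the first step alone reaches the
   target. *)
assert (H1 : 0 <= B / h) by (apply Rdiv_le_0_compat; lra).
assert (H2 : 0 <= (1 - th) / h) by (apply Rdiv_le_0_compat; lra).
destruct (poincare_miranda
  (fun z => val (run h (fst z) (snd z) (S n)) - B)
  (fun z => gap (run h (fst z) (snd z) (S n)) - (1 - th)) (B / h) ((1 - th) / h) H1 H2)
  as [a [b [Ha [Hb [E1 E2]]]]].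
- intros z. apply filterlim_Rminus; [|apply filterlim_const].
  apply (run_continuous h (S n) Hh z).
- intros z. apply filterlim_Rminus; [|apply filterlim_const].
  apply (run_continuous h (S n) Hh z).
- intros y Hy. cbn [fst snd]. rewrite (proj1 (run_val_zero h y (S n))). lra.
- intros y Hy. cbn [fst snd].
  destruct (run_ge_first h (B / h) y n Hh H1 (proj1 Hy)) as [H _].
  replace (h * (B / h)) with B in H by (field; lra). lra.
- intros x Hx. cbn [fst snd]. rewrite (proj1 (run_gap_zero h x (S n))). lra.
- intros x Hx. cbn [fst snd].
  destruct (run_ge_first h x ((1 - th) / h) n Hh (proj1 Hx) H2) as [_ H].
  replace (h * ((1 - th) / h)) with (1 - th) in H by (field; lra). lra.
- cbn [fst snd] in *. exists a, b. lra.
Qed.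

(** The second derivative dictated by the equation. The scheme inserts the new slope as [g'] while
    [source] holds the old one; in the limit both are the derivative. *)
Definition slope_rate (x p source g' : R) : R :=
  (source - drift p * x * g') / ((sg * x) ^ 2 / 2).

Lemma slope_rate_eq (x p source g' : R) : 0 < x ->
  (sg * x) ^ 2 / 2 * slope_rate x p source g' = source - drift p * x * g'.
Proof. intros Hx. unfold slope_rate. field. lra. Qed.

Definition drift_bound : R := (la + r) / th + sg ^ 2 + la + Rabs mu.

Definition rate_bound (T X : R) : R :=
  2 / sg ^ 2 * ((r + la) * T + / th + drift_bound * X).

(** Supplies [Hk] of the grid argument: [x ^ 2] cancels the degeneracy, the source yields the upper
    bound in the old slope [g], the drift the lower bound in the new slope [g']. The rate [k0] is
    [r] for the value and [r + la] for the gap. *)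
Lemma slope_rate_bounds (k0 T X x p f g source g' : R) :
  0 <= k0 <= r + la -> 0 < x <= X -> th <= p <= 1 -> 0 <= f <= T -> 0 <= g -> 0 <= g' ->
  k0 * f <= source <= k0 * f + g / th ->
  - (rate_bound T X * g') <= slope_rate x p source g' * x ^ 2 <= rate_bound T X * (1 + g).
Proof.
intros Hk0 Hx Hp Hf Hg Hg' Hs.
pose proof (drift_bounds p Hp) as Hd. fold drift_bound in Hd.
assert (H2 : 0 < 2 / sg ^ 2) by (apply Rdiv_lt_0_compat; [lra|apply pow_lt; lra]).
assert (Hi : 0 < / th) by (apply Rinv_0_lt_compat; lra).
replace (slope_rate x p source g' * x ^ 2) with (2 / sg ^ 2 * (source - drift p * x * g'))
  by (unfold slope_rate; field; lra).
unfold rate_bound.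
assert (Hdx : 0 <= drift p * x <= drift_bound * X) by (split; nra).
assert (HT : 0 <= k0 * f <= (r + la) * T) by (split; nra).
assert (Hgt : 0 <= g / th) by (apply Rdiv_le_0_compat; lra).
replace (- (2 / sg ^ 2 * ((r + la) * T + / th + drift_bound * X) * g'))
  with (2 / sg ^ 2 * - (((r + la) * T + / th + drift_bound * X) * g')) by ring.
rewrite (Rmult_assoc (2 / sg ^ 2) _ (1 + g)). unfold Rdiv in Hs, Hgt.
assert (drift p * x * g' <= drift_bound * X * g') by (apply Rmult_le_compat_r; lra).
assert (0 <= drift p * x * g') by (apply Rmult_le_pos; lra).
assert (0 <= ((r + la) * T + / th) * g') by (apply Rmult_le_pos; lra).
assert (0 <= ((r + la) * T + drift_bound * X) * g) by (apply Rmult_le_pos; lra).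
split; apply Rmult_le_compat_l; try lra; nra.
Qed.

Definition singular_bound : R := drift_bound + 2 / sg ^ 2 * (r + la + / th).

Lemma singular_bound_ge0 : 0 <= singular_bound.
Proof.
unfold singular_bound. pose proof (drift_bounds 1 ltac:(lra)) as Hd. fold drift_bound in Hd.
assert (0 < / th) by (apply Rinv_0_lt_compat; lra).
assert (0 < 2 / sg ^ 2) by (apply Rdiv_lt_0_compat; [lra|apply pow_lt; lra]). nra.
Qed.

(** Supplies [Hlow] and [Hup] with [s = sg ^ 2 / 2]. The first combines the lower bound on the
    source with the upper bound on the drift; the second discards the nonnegative drift term. *)
Lemma slope_rate_singular (k0 x p f g source : R) :
  0 <= k0 <= r + la -> 0 < x -> th <= p <= 1 -> 0 <= f -> 0 <= g ->
  k0 * f <= source <= k0 * f + g / th ->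
  k0 * f <= sg ^ 2 / 2 * x ^ 2 * slope_rate x p source g + singular_bound * x * g /\
  x ^ 2 * slope_rate x p source g <= singular_bound * (f + g).
Proof.
intros Hk0 Hx Hp Hf Hg Hs.
pose proof (drift_bounds p Hp) as Hd. fold drift_bound in Hd.
assert (Hi : 0 < / th) by (apply Rinv_0_lt_compat; lra).
assert (H2 : 0 < 2 / sg ^ 2) by (apply Rdiv_lt_0_compat; [lra|apply pow_lt; lra]).
assert (Hrate : sg ^ 2 / 2 * x ^ 2 * slope_rate x p source g = source - drift p * x * g)
  by (unfold slope_rate; field; lra).
assert (Hsx : 0 <= 2 / sg ^ 2 * (r + la + / th)) by (apply Rmult_le_pos; lra).
assert (Hxg : 0 <= x * g) by (apply Rmult_le_pos; lra).
assert (Hdg : 0 <= drift p * x * g) by (rewrite Rmult_assoc; apply Rmult_le_pos; lra).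
assert (Hds : drift p <= singular_bound) by (unfold singular_bound; lra).
split.
- rewrite Hrate, (Rmult_assoc singular_bound), (Rmult_assoc (drift p)).
  assert (drift p * (x * g) <= singular_bound * (x * g)) by (apply Rmult_le_compat_r; lra).
  lra.
- replace (x ^ 2 * slope_rate x p source g)
    with (2 / sg ^ 2 * (source - drift p * x * g)) by (rewrite <- Hrate; field; lra).
  apply Rle_trans with (2 / sg ^ 2 * (r + la + / th) * (f + g)).
  + rewrite (Rmult_assoc (2 / sg ^ 2) _ (f + g)). apply Rmult_le_compat_l; [lra|].
    unfold Rdiv in Hs.
    assert (k0 * f <= (r + la) * f) by (apply Rmult_le_compat_r; lra).
    assert (0 <= (r + la) * g) by (apply Rmult_le_pos; lra).
    assert (0 <= / th * f) by (apply Rmult_le_pos; lra). lra.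
  + apply Rmult_le_compat_r; [lra|]. unfold singular_bound. lra.
Qed.

(** The shooting solutions on all grids are grid functions with bounded second differences away from
    0; their limits solve the system with [clip q] in place of [p]. *)
Lemma coupled_solution_exists (X B : R) : 0 < X -> 0 <= B ->
  exists v v' v'' q q' q'' : R -> R, v X = B /\ q X = 1 - th /\
  forall x, 0 < x <= X ->
    (D_in v v' (fun x => 0 < x <= X) x /\ D_in v' v'' (fun x => 0 < x <= X) x /\
     continue_in v'' (fun x => 0 < x <= X) x) /\
    (D_in q q' (fun x => 0 < x <= X) x /\ D_in q' q'' (fun x => 0 < x <= X) x /\
     continue_in q'' (fun x => 0 < x <= X) x) /\
    0 <= v x /\ 0 <= v' x /\ 0 <= q x /\ 0 <= q' x /\
    v'' x = slope_rate x (clip (q x)) (val_source (v x) (v' x) (q x)) (v' x) /\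
    q'' x = slope_rate x (clip (q x)) (gap_source (v' x) (q x) (q' x)) (q' x).
Proof.
intros HX HB.
destruct ultrafilter_on_nat as [U [PU [HU HUe]]].
assert (Hshoot : forall n, exists ab : R * R, 0 <= fst ab /\ 0 <= snd ab /\
  val (run (mesh X n) (fst ab) (snd ab) (S n)) = B /\
  gap (run (mesh X n) (fst ab) (snd ab) (S n)) = 1 - th).
{ intros n. destruct (run_shooting (mesh X n) B n (mesh_pos X HX n) HB) as [a [b H]].
  now exists (a, b). }
set (ab := fun n => proj1_sig (constructive_indefinite_description _ (Hshoot n))).
assert (Hab : forall n, 0 <= fst (ab n) /\ 0 <= snd (ab n) /\
  val (run (mesh X n) (fst (ab n)) (snd (ab n)) (S n)) = B /\
  gap (run (mesh X n) (fst (ab n)) (snd (ab n)) (S n)) = 1 - th)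
  by (intros n; exact (proj2_sig (constructive_indefinite_description _ (Hshoot n)))).
clearbody ab. clear Hshoot.
set (st := fun t : nat * nat => run (mesh X (fst t)) (fst (ab (fst t))) (snd (ab (fst t))) (snd t)).
assert (Hpos : forall t, 0 <= val (st t) /\ 0 <= val_slope (st t) /\ 0 <= gap (st t) /\ 0 <= gap_slope (st t)).
{ intros t. apply run_nonneg; [now apply mesh_pos|apply Hab|apply Hab]. }
assert (Hstep : forall t, st (shift t) = step (mesh X (fst t)) (node X (shift t)) (st t)) by reflexivity.
(* The discrete second derivatives mix terms at [t] and at [shift t]; since these have equal limits,
   the limits of [kv] and [kq] are the second derivatives that the equations prescribe. *)
set (kv := fun t => slope_rate (node X (shift t)) (clip (gap (st (shift t))))
  (val_source (val (st (shift t))) (val_slope (st t)) (gap (st (shift t)))) (val_slope (st (shift t)))).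
set (kq := fun t => slope_rate (node X (shift t)) (clip (gap (st (shift t))))
  (gap_source (val_slope (st t)) (gap (st (shift t))) (gap_slope (st t))) (gap_slope (st (shift t)))).
assert (Hnode : forall t, 0 < node X (shift t)).
{ intros t. apply Rmult_lt_0_compat; [now apply mesh_pos|apply lt_0_INR; simpl; lia]. }
assert (Hnode' : forall t, (snd t <= fst t)%nat -> 0 < node X (shift t) <= X).
{ intros t Ht. split; [apply Hnode|].
  apply Rle_trans with (2 := Req_le _ _ (mesh_last X (fst t))).
  apply Rmult_le_compat_l; [left; now apply mesh_pos|apply le_INR; simpl; lia]. }
assert (Ev : forall t, val (st (shift t)) = val (st t) + mesh X (fst t) * val_slope (st t))
  by (intros; now rewrite Hstep).
assert (Eq : forall t, gap (st (shift t)) = gap (st t) + mesh X (fst t) * gap_slope (st t))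
  by (intros; now rewrite Hstep).
assert (Ev' : forall t, val_slope (st (shift t)) = val_slope (st t) + mesh X (fst t) * kv t).
{ intros t. unfold kv. rewrite Hstep. unfold step. cbn [val val_slope gap gap_slope].
  apply next_slope_eq; [now apply mesh_pos|apply Hnode|apply clip_bounds]. }
assert (Eq' : forall t, gap_slope (st (shift t)) = gap_slope (st t) + mesh X (fst t) * kq t).
{ intros t. unfold kq. rewrite Hstep. unfold step. cbn [val val_slope gap gap_slope].
  apply next_slope_eq; [now apply mesh_pos|apply Hnode|apply clip_bounds]. }
assert (Tv : forall n, val (st (n, S n)) = B) by (intros n; apply (Hab n)).
assert (Tq : forall n, gap (st (n, S n)) = 1 - th) by (intros n; apply (Hab n)).
assert (Hrb : forall T, 0 <= T -> 0 <= rate_bound T X).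
{ intros T HT. unfold rate_bound. pose proof (drift_bounds 1 ltac:(lra)) as Hd. fold drift_bound in Hd.
  assert (0 < / th) by (apply Rinv_0_lt_compat; lra).
  apply Rmult_le_pos; [apply Rdiv_le_0_compat; [lra|apply pow_lt; lra]|].
  assert (0 <= (r + la) * T) by (apply Rmult_le_pos; lra).
  assert (0 <= drift_bound * X) by (apply Rmult_le_pos; lra). lra. }
destruct (second_order_grid_limit U PU HU HUe X HX (fun t => val (st t)) (fun t => val_slope (st t)) kv
  B (rate_bound B X) (Hrb B HB) Ev Ev') as [v [v' [Lv TvX]]]; [apply Hpos|apply Hpos|exact Tv| |].
{ intros t Ht. apply (slope_rate_bounds r B X _ _ (val (st (shift t))));
    auto; try apply Hpos; try lra.
  - apply clip_bounds.
  - split; [apply Hpos|].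
    apply (grid_value_le X HX (fun t => val (st t)) (fun t => val_slope (st t)) B Ev);
      [apply Hpos|exact Tv|simpl; lia].
  - apply val_source_bounds; apply Hpos. }
destruct (second_order_grid_limit U PU HU HUe X HX (fun t => gap (st t)) (fun t => gap_slope (st t)) kq
  (1 - th) (rate_bound (1 - th) X) (Hrb (1 - th) ltac:(lra)) Eq Eq') as [q [q' [Lq TqX]]];
  [apply Hpos|apply Hpos|exact Tq| |].
{ intros t Ht. apply (slope_rate_bounds (r + la) (1 - th) X _ _ (gap (st (shift t))));
    auto; try apply Hpos; try lra.
  - apply clip_bounds.
  - split; [apply Hpos|].
    apply (grid_value_le X HX (fun t => gap (st t)) (fun t => gap_slope (st t)) (1 - th) Eq);
      [apply Hpos|exact Tq|simpl; lia].
  - apply gap_source_bounds; apply Hpos. }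
set (v'' := fun x => slope_rate x (clip (q x)) (val_source (v x) (v' x) (q x)) (v' x)).
set (q'' := fun x => slope_rate x (clip (q x)) (gap_source (v' x) (q x) (q' x)) (q' x)).
assert (Lk : forall x, on_interval X x ->
  filterlim kv (near_node U X x) (locally (v'' x)) /\
  filterlim kq (near_node U X x) (locally (q'' x))).
{ intros x Hx. pose proof (near_node_proper U PU HUe X HX x Hx) as PN.
  pose proof (@filter_filter _ _ PN) as FN.
  destruct (Lv x Hx) as [Lv0 [Lv1 [Lu0 Lu1]]]. destruct (Lq x Hx) as [Lq0 [Lq1 [Lw0 Lw1]]].
  assert (Lx : filterlim (fun t => node X (shift t)) (near_node U X x) (locally x)).
  { apply (filterlim_shift U PU HUe X HX (node X) (fun _ => 1) x x 1).
    - intros t. unfold node, shift. cbn [fst snd]. rewrite S_INR. ring.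
    - apply filter_forall. intros _. rewrite Rabs_R1. lra.
    - now apply filterlim_node. }
  pose proof (clip_bounds (q x)) as Hc.
  assert (Lc : filterlim (fun t => clip (gap (st (shift t)))) (near_node U X x) (locally (clip (q x)))).
  { exact (filterlim_continuous clip _ _ (continuous_clip th (q x)) Lq1). }
  assert (Ld : filterlim (fun t => drift (clip (gap (st (shift t))))) (near_node U X x)
    (locally (drift (clip (q x))))).
  { unfold drift. repeat first [apply filterlim_Rminus|apply filterlim_Rplus|apply filterlim_const].
    apply filterlim_Rdiv; [lra|apply filterlim_const|exact Lc]. }
  assert (La : filterlim (fun t => val_slope (st t) / clip (gap (st (shift t)))) (near_node U X x)
    (locally (v' x / clip (q x)))).
  { apply filterlim_Rdiv; [lra|exact Lu0|exact Lc]. }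
  assert (Lr : forall (src g : nat * nat -> R) a b,
    filterlim src (near_node U X x) (locally a) -> filterlim g (near_node U X x) (locally b) ->
    filterlim (fun t => slope_rate (node X (shift t)) (clip (gap (st (shift t)))) (src t) (g t))
      (near_node U X x) (locally (slope_rate x (clip (q x)) a b))).
  { intros src g a b Ls Lg. unfold slope_rate. apply filterlim_Rdiv.
    - assert (0 < (sg * x) ^ 2); [|lra]. destruct Hx. apply pow_lt. nra.
    - apply filterlim_Rminus; [exact Ls|]. apply filterlim_Rmult; [|exact Lg].
      now apply filterlim_Rmult.
    - apply filterlim_Rdiv; [lra| |apply filterlim_const].
      assert (Lsx : filterlim (fun t => sg * node X (shift t)) (near_node U X x) (locally (sg * x)))
        by (apply filterlim_Rmult; [apply filterlim_const|exact Lx]).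
      cbn [pow]. repeat first [exact Lsx|apply filterlim_const|apply filterlim_Rmult]. }
  split; apply Lr; try assumption.
  - apply filterlim_Rminus; [apply filterlim_Rmult; [apply filterlim_const|exact Lv1]|].
    exact (filterlim_continuous M _ _ (CM _) La).
  - apply filterlim_Rplus; [apply filterlim_Rmult; [apply filterlim_const|exact Lq1]|].
    apply filterlim_Rmult; [|exact Lw0].
    apply filterlim_Rdiv; [lra| |exact Lc].
    exact (filterlim_continuous om _ _ (Com _) La). }
exists v, v', v'', q, q', q''. split; [exact TvX|]. split; [exact TqX|].
intros x Hx.
assert (Hlim0 : forall f l, (forall t, 0 <= f t) ->
  filterlim f (near_node U X x) (locally l) -> 0 <= l).
{ intros f l Hf Hl. pose proof (near_node_proper U PU HUe X HX x Hx) as PN.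
  apply (filterlim_R_le (F := near_node U X x) (fun _ => 0) f); [|apply filterlim_const|exact Hl].
  now apply filter_forall. }
split; [split; [|split]|split; [split; [|split]|]].
- apply (grid_limit_derivative U PU HUe X HX (fun t => val (st t)) (fun t => val_slope (st t)));
    [exact Ev|apply Lv|apply Lv|exact Hx].
- apply (grid_limit_derivative U PU HUe X HX (fun t => val_slope (st t)) kv);
    [exact Ev'|apply Lv|apply Lk|exact Hx].
- apply (grid_limit_continuous U PU HUe X HX kv); [apply Lk|exact Hx].
- apply (grid_limit_derivative U PU HUe X HX (fun t => gap (st t)) (fun t => gap_slope (st t)));
    [exact Eq|apply Lq|apply Lq|exact Hx].
- apply (grid_limit_derivative U PU HUe X HX (fun t => gap_slope (st t)) kq);
    [exact Eq'|apply Lq|apply Lk|exact Hx].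
- apply (grid_limit_continuous U PU HUe X HX kq); [apply Lk|exact Hx].
- destruct (Lv x Hx) as [Lv0 [_ [Lu0 _]]]. destruct (Lq x Hx) as [Lq0 [_ [Lw0 _]]].
  split; [|split; [|split; [|split]]];
    [eapply Hlim0; [|exact Lv0]|eapply Hlim0; [|exact Lu0]
    |eapply Hlim0; [|exact Lq0]|eapply Hlim0; [|exact Lw0]|]; try (intros t; apply Hpos).
  split; reflexivity.
Qed.

End Scheme.

(** * Existence *)

Theorem theorem3p1 :
  forall (L : R -> R) (r lambda mu sigma B xstar theta : R),
    r > mu -> mu >= 0 -> lambda > 0 -> B > 0 -> xstar > 0 ->
    0 <= theta <= 1 ->
    assumption_A L ->
    sigma > 0 ->
    theta > 0 ->
    exists V p : R -> R,
      is_C2_solution L r lambda mu sigma B xstar theta V p /\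
      (forall x, 0 <= x <= xstar -> 0 <= V x <= B) /\
      (forall x, 0 <= x <= xstar -> theta <= p x <= 1) /\
      (forall x y, 0 <= x -> x < y -> y <= xstar -> V x < V y) /\
      (forall x y, 0 <= x -> x < y -> y <= xstar -> p y <= p x) /\
      (theta < 1 ->
       forall x y, 0 <= x -> x < y -> y <= xstar -> p y < p x).
Proof.
intros L r la mu sg B X th Hrmu Hmu Hla HB HX Hth01 HA Hsg Hth0.
destruct (min_cost_derivative L HA) as [om [Hom [Com Dom]]].
assert (Hr : 0 < r) by lra. assert (Hth : 0 < th <= 1) by lra.
assert (HM : forall a, 0 <= a -> - a <= min_cost L a <= 0)
  by (intros a; now apply min_cost_bounds).
assert (CM : forall a, continuous (min_cost L) a)
  by (intros a; exact (ex_derive_continuous (min_cost L) a (ex_intro _ _ (Dom a)))).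
destruct (coupled_solution_exists (min_cost L) om r la mu sg th Hr Hla ltac:(lra) Hsg Hth HM CM
  Hom Com X B HX ltac:(lra)) as [v [v' [v'' [q [q' [q'' [EvX [EqX Hsol]]]]]]]].
set (D := fun x => 0 < x <= X) in *.
assert (Dv : forall x, D x -> D_in v v' D x) by (intros x Hx; apply (Hsol x Hx)).
assert (Dv' : forall x, D x -> D_in v' v'' D x) by (intros x Hx; apply (Hsol x Hx)).
assert (Dq : forall x, D x -> D_in q q' D x) by (intros x Hx; apply (Hsol x Hx)).
assert (Dq' : forall x, D x -> D_in q' q'' D x) by (intros x Hx; apply (Hsol x Hx)).
assert (Pv : forall x, D x -> 0 <= v x) by (intros x Hx; apply (Hsol x Hx)).
assert (Pv' : forall x, D x -> 0 <= v' x) by (intros x Hx; apply (Hsol x Hx)).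
assert (Pq : forall x, D x -> 0 <= q x) by (intros x Hx; apply (Hsol x Hx)).
assert (Pq' : forall x, D x -> 0 <= q' x) by (intros x Hx; apply (Hsol x Hx)).
(* Monotonicity and the boundary value at [X] give the bound that makes the truncation inactive. *)
assert (Dqc : forall x, D x -> q x <= 1 - th).
{ intros x Hx. rewrite <- EqX. destruct Hx.
  apply (singular_nondecreasing X q q' Dq Pq'); lra. }
assert (Dvc : forall x, D x -> v x <= B).
{ intros x Hx. rewrite <- EvX. destruct Hx.
  apply (singular_nondecreasing X v v' Dv Pv'); lra. }
assert (Hclip : forall x, D x -> clip th (q x) = 1 - q x).
{ intros x Hx. specialize (Pq x Hx). specialize (Dqc x Hx).
  unfold clip. rewrite Rmax_right, Rmin_right; lra. }
set (C := singular_bound r la mu sg th).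
assert (HC : 0 <= C) by (apply singular_bound_ge0; lra).
assert (Hs : 0 < sg ^ 2 / 2) by (assert (0 < sg ^ 2) by (apply pow_lt; lra); lra).
assert (Sv : forall x, D x -> r * v x <= sg ^ 2 / 2 * x ^ 2 * v'' x + C * x * v' x /\
  x ^ 2 * v'' x <= C * (v x + v' x)).
{ intros x Hx. destruct (Hsol x Hx) as [_ [_ [_ [_ [_ [_ [-> _]]]]]]].
  apply slope_rate_singular; auto; try lra; [apply Hx|apply clip_bounds; lra|].
  apply val_source_bounds; auto. }
assert (Sq : forall x, D x -> (r + la) * q x <= sg ^ 2 / 2 * x ^ 2 * q'' x + C * x * q' x /\
  x ^ 2 * q'' x <= C * (q x + q' x)).
{ intros x Hx. destruct (Hsol x Hx) as [_ [_ [_ [_ [_ [_ [_ ->]]]]]]].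
  apply slope_rate_singular; auto; try lra; [apply Hx|apply clip_bounds; lra|].
  apply gap_source_bounds; auto. }
assert (V0 := singular_vanishes_at_0 X _ r C HX Hs Hr HC v v' v'' Dv Dv' Pv Pv'
  (fun x Hx => proj1 (Sv x Hx))).
assert (Q0 := singular_vanishes_at_0 X _ (r + la) C HX Hs ltac:(lra) HC q q' q'' Dq Dq' Pq Pq'
  (fun x Hx => proj1 (Sq x Hx))).
assert (Iv : forall x y, 0 < x -> x < y -> y <= X -> v x < v y).
{ intros x y. apply (singular_increasing X _ r C HX Hr HC v v' v'' Dv Dv' Pv Pv'
    (fun x Hx => proj1 (Sv x Hx)) (fun x Hx => proj2 (Sv x Hx))). lra. }
(* Strictness rests on [q X = 1 - th > 0]; for [th = 1] the gap vanishes identically and [p] is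
   constant. *)
assert (Iq : th < 1 -> forall x y, 0 < x -> x < y -> y <= X -> q x < q y).
{ intros Hth1 x y. apply (singular_increasing X _ (r + la) C HX ltac:(lra) HC q q' q'' Dq Dq' Pq Pq'
    (fun x Hx => proj1 (Sq x Hx)) (fun x Hx => proj2 (Sq x Hx))). lra. }
set (V := fun x => if Rle_dec x 0 then 0 else v x).
set (p := fun x => if Rle_dec x 0 then 1 else 1 - q x).
assert (EV : forall x, 0 < x -> V x = v x) by (intros x Hx; unfold V; destruct Rle_dec; lra).
assert (Ep : forall x, 0 < x -> p x = 1 - q x) by (intros x Hx; unfold p; destruct Rle_dec; lra).
assert (EV0 : V 0 = 0) by (unfold V; destruct Rle_dec; lra).
assert (Ep0 : p 0 = 1) by (unfold p; destruct Rle_dec; lra).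
assert (Dp : forall x, D x -> D_in (fun x => 1 - q x) (fun x => - q' x) D x).
{ intros x Hx.
  pose proof (Dminus D (fun _ => 0) q' (fun _ => 1) q x (Dconst D 1 x) (Dq x Hx)) as H.
  unfold D_in in H |- *. now rewrite Rminus_0_l in H. }
assert (Cv : forall x, D x -> continue_in v D x)
  by (intros x Hx; exact (D_in_continue_in v v' D x (Dv x Hx))).
assert (Cp : forall x, D x -> continue_in (fun x => 1 - q x) D x)
  by (intros x Hx; exact (D_in_continue_in _ _ D x (Dp x Hx))).
exists V, p. split; [|split; [|split; [|split; [|split]]]].
- split; [|split; [|split; [|split; [|split; [|split]]]]].
  + apply (extend_by_0_continuous v X 0 Cv). intros e He.
    destruct (V0 e He) as [d [Hd Hd']]. exists d. split; [exact Hd|].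
    intros x Hx Hxd. specialize (Pv x Hx). specialize (Hd' x Hx Hxd).
    rewrite Rminus_0_r, Rabs_pos_eq; lra.
  + apply (extend_by_0_continuous (fun x => 1 - q x) X 1 Cp). intros e He.
    destruct (Q0 e He) as [d [Hd Hd']]. exists d. split; [exact Hd|].
    intros x Hx Hxd. specialize (Pq x Hx). specialize (Hd' x Hx Hxd).
    apply Rabs_lt_between. lra.
  + exists v', v'', (fun x => - q' x), (fun x => - q'' x).
    split; [|split].
    * intros x Hx. split; [|split; [now apply Dv'|apply (Hsol x Hx)]].
      apply (D_in_ext_on v V v' D x Hx); [|now apply Dv].
      intros y Hy. symmetry. apply EV, Hy.
    * intros x Hx. split; [|split].
      -- apply (D_in_ext_on (fun x => 1 - q x) p _ D x Hx); [|now apply Dp].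
         intros y Hy. symmetry. apply Ep, Hy.
      -- now apply Dopp, Dq'.
      -- exact (limit_Ropp q'' _ (q'' x) x (proj2 (proj2 (proj1 (proj2 (Hsol x Hx)))))).
    * intros x Hx.
      rewrite EV, Ep by apply Hx.
      assert (Hq1 : 1 - q x <> 0) by (specialize (Dqc x Hx); lra).
      (* The chain rule with the derivative [- om] of the minimal cost; [1 - q x >= th > 0] permits
         the division. *)
      assert (Hder : is_derive (fun xi => hamiltonian L r la mu sg x xi (1 - q x)) (v' x)
        (- om (v' x / (1 - q x)) / (1 - q x) + drift r la mu sg (1 - q x) * x)).
      { unfold hamiltonian. fold (drift r la mu sg (1 - q x)).
        apply (is_derive_plus (fun xi => min_cost L (xi / (1 - q x)))).
        - replace (- om (v' x / (1 - q x)) / (1 - q x))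
            with (scal (/ (1 - q x)) (- om (v' x / (1 - q x))))
            by (unfold scal; simpl; unfold mult; simpl; unfold Rdiv; ring).
          apply (is_derive_comp (min_cost L)); [apply Dom|].
          auto_derive; [exact I|field; exact Hq1].
        - auto_derive; [exact I|ring]. }
      assert (Hxi : hamiltonian_xi L r la mu sg x (v' x) (1 - q x)
        = - om (v' x / (1 - q x)) / (1 - q x) + drift r la mu sg (1 - q x) * x)
        by exact (is_derive_unique _ _ _ Hder).
      rewrite Hxi.
      destruct (Hsol x Hx) as [_ [_ [_ [_ [_ [_ [Ev'' Eq'']]]]]]].
      (* With the truncation removed, the limit equations multiplied by [(sg * x) ^ 2 / 2] are the
         two ODEs, the second up to the sign from [p = 1 - q]. *)
      rewrite (Hclip x Hx) in Ev'', Eq''.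
      assert (E1 := slope_rate_eq r la mu sg Hsg x (1 - q x)
        (val_source (min_cost L) r th (v x) (v' x) (q x)) (v' x) (proj1 Hx)).
      assert (E2 := slope_rate_eq r la mu sg Hsg x (1 - q x)
        (gap_source om r la th (v' x) (q x) (q' x)) (q' x) (proj1 Hx)).
      rewrite <- Ev'' in E1. rewrite <- Eq'' in E2.
      unfold val_source in E1. unfold gap_source in E2. rewrite (Hclip x Hx) in E1, E2.
      split.
      -- unfold hamiltonian. fold (drift r la mu sg (1 - q x)). lra.
      -- unfold Rdiv in *. lra.
  + exact EV0.
  + rewrite EV; lra.
  + exact Ep0.
  + rewrite Ep; lra.
- intros x Hx. destruct (Req_dec x 0) as [->|Hx0]; [lra|].
  rewrite EV by lra. assert (Dx : D x) by (unfold D; lra). auto.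
- intros x Hx. destruct (Req_dec x 0) as [->|Hx0]; [lra|].
  rewrite Ep by lra. assert (Dx : D x) by (unfold D; lra).
  specialize (Dqc x Dx). specialize (Pq x Dx). lra.
- intros x y Hx Hxy Hy. rewrite (EV y) by lra.
  destruct (Req_dec x 0) as [->|Hx0]; [|rewrite EV by lra; apply Iv; lra].
  (* Strictness from 0 passes through [y / 2], where [v] is nonnegative and strict monotonicity on
     []0, X]] applies. *)
  rewrite EV0. apply Rle_lt_trans with (v (y / 2)); [apply Pv; unfold D; lra|apply Iv; lra].
- intros x y Hx Hxy Hy. rewrite (Ep y) by lra.
  destruct (Req_dec x 0) as [->|Hx0].
  + rewrite Ep0. assert (0 <= q y) by (apply Pq; unfold D; lra). lra.
  + rewrite Ep by lra. assert (q x <= q y); [|lra].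
    apply (singular_nondecreasing X q q' Dq Pq'); lra.
- intros Hth1 x y Hx Hxy Hy. rewrite (Ep y) by lra.
  destruct (Req_dec x 0) as [->|Hx0].
  + rewrite Ep0. assert (q (y / 2) < q y) by (apply Iq; lra).
    assert (0 <= q (y / 2)) by (apply Pq; unfold D; lra). lra.
  + rewrite Ep by lra. assert (q x < q y) by (apply Iq; lra). lra.
Qed.
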